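(* Let $R=(r_{ij})$ be a real symmetric $n\times n$ matrix with zero diagonal and $\rho(|R|)<1$, let $G$ be its graph, let $\alpha_{ij}$ be the Gaussian belief propagation messages and $Z^{\mathrm{bp}}$ the belief-propagation determinant estimate (all defined in the context). Then $$Z^{\mathrm{bp}}=\prod_{\ell\in\mathcal{L}_\emptyset}(1-R^\ell)^{-1},$$ where the product is over the set $\mathcal{L}_\emptyset$ of all totally backtracking orbits of $G$.
   Context: $|R|=(|r_{ij}|)$ is the entrywise absolute value and $\rho$ the spectral radius. $G$ is the graph on $V=\{1,\dots,n\}$ with undirected edge $\{i,j\}$ whenever $r_{ij}\neq0$; $\partial i$ is the set of neighbours of $i$; each undirected edge gives two directed edges $(ij),(ji)$. A walk is a sequence of vertices $(w_0,\dots,w_L)$ with $\{w_t,w_{t+1}\}\in G$; its steps are $(w_tw_{t+1})$; it is closed if $L\ge1$, $w_0=w_L$; a closed walk is primitive if it is not an $m$-fold concatenation ($m\ge2$) of a shorter closed walk. An orbit is an equivalence class of closed primitive walks under cyclic shifts. $n_{ij}(\ell)$ is the number of occurrences of step $(ij)$ in orbit $\ell$ and $R^\ell=\prod r_{ij}^{n_{ij}(\ell)}$. An orbit is regarded as a cyclic sequence of steps (the step following $(w_{L-1}w_L)$ is $(w_0w_1)$); a backtracking pair is a pair of cyclically consecutive steps of the form $(ij)(ji)$. Repeatedly deleting backtracking pairs (cyclically) until none remain gives the irreducible core of the orbit; the orbit is totally backtracking if its irreducible core is empty. GaBP messages: for each directed edge $(ij)$ of $G$, $\alpha_{ij}=\lim_{t\to\infty}\alpha^{(t)}_{ij}$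 where $\alpha^{(0)}_{ij}=0$ and $\alpha^{(t+1)}_{ij}=r_{ij}^2\,(1-\sum_{k\in\partial i\setminus j}\alpha^{(t)}_{ki})^{-1}$ (when $\rho(|R|)<1$ this iteration converges and $1-\alpha_{i\setminus j}>0$). Write $\alpha_{i\setminus j}=\sum_{k\in\partial i\setminus j}\alpha_{ki}$. Define $Z_i^{\mathrm{bp}}=(1-\sum_{k\in\partial i}\alpha_{ki})^{-1}$, and for each edge $\{i,j\}$, $Z_{ij}^{\mathrm{bp}}=\det\begin{pmatrix}1-\alpha_{i\setminus j} & -r_{ij}\\ -r_{ij} & 1-\alpha_{j\setminus i}\end{pmatrix}^{-1}$. Then $Z^{\mathrm{bp}}=\prod_{i\in V}Z_i^{\mathrm{bp}}\prod_{\{i,j\}\in G}\frac{Z_{ij}^{\mathrm{bp}}}{Z_i^{\mathrm{bp}}Z_j^{\mathrm{bp}}}$. *)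

(* Defs.v *)
From HB Require Import structures.
From mathcomp Require Import all_boot all_order all_algebra.
From mathcomp Require Import complex.
From mathcomp Require Import all_classical all_reals all_analysis.
Set Implicit Arguments. Unset Strict Implicit. Unset Printing Implicit Defensive.
Import Order.TTheory GRing.Theory Num.Theory.
Local Open Scope ring_scope.

Definition absmx (R : realType) (n : nat) (A : 'M[R]_n) : 'M[R]_n :=
  map_mx (fun x => `|x|) A.

Definition spectral_radius_lt1 (R : realType) (n : nat) (B : 'M[R]_n) : Prop :=
  forall lam : R[i], eigenvalue (map_mx (real_complex R) B) lam -> `|lam| < 1.

Definition adj (R : realType) (n : nat) (A : 'M[R]_n) : rel 'I_n :=
  fun i j => A i j != 0.

(* alpha_iter A t k i = alpha^{(t)}_{ki}  (message on directed edge (ki)) *)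
Fixpoint alpha_iter (R : realType) (n : nat) (A : 'M[R]_n) (t : nat) : 'I_n -> 'I_n -> R :=
  match t with
  | 0 => fun _ _ => 0
  | t'.+1 => fun i j =>
      A i j ^+ 2 / (1 - \sum_(k | adj A i k && (k != j)) alpha_iter A t' k i)
  end.

Definition alpha_except (R : realType) (n : nat) (A : 'M[R]_n)
  (alpha : 'I_n -> 'I_n -> R) (i j : 'I_n) : R :=
  \sum_(k | adj A i k && (k != j)) alpha k i.

Definition Zi_bp (R : realType) (n : nat) (A : 'M[R]_n)
  (alpha : 'I_n -> 'I_n -> R) (i : 'I_n) : R :=
  (1 - \sum_(k | adj A i k) alpha k i)^-1.

(* inverse of det [[1 - a_{i\j}, -r_ij], [-r_ij, 1 - a_{j\i}]] *)
Definition Zij_bp (R : realType) (n : nat) (A : 'M[R]_n)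
  (alpha : 'I_n -> 'I_n -> R) (i j : 'I_n) : R :=
  ((1 - alpha_except A alpha i j) * (1 - alpha_except A alpha j i)
     - (- A i j) * (- A i j))^-1.

Definition Z_bp (R : realType) (n : nat) (A : 'M[R]_n)
  (alpha : 'I_n -> 'I_n -> R) : R :=
  (\prod_(i : 'I_n) Zi_bp A alpha i) *
  \prod_(p : 'I_n * 'I_n | (p.1 < p.2)%N && adj A p.1 p.2)
     (Zij_bp A alpha p.1 p.2 / (Zi_bp A alpha p.1 * Zi_bp A alpha p.2)).

(* A closed walk (w_0,...,w_L) with w_L = w_0 is represented by the sequence
   [:: w_0; ...; w_{L-1}] of length L >= 1; its steps are (w_t w_{t+1}),
   indices taken cyclically. *)
Definition closed_walk (R : realType) (n : nat) (A : 'M[R]_n) (s : seq 'I_n) : bool :=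
  (0 < size s)%N && cycle (adj A) s.

Definition primitive (R : realType) (n : nat) (A : 'M[R]_n) (s : seq 'I_n) : Prop :=
  ~ exists (m : nat) (t : seq 'I_n),
      (1 < m)%N /\ closed_walk A t /\ s = flatten (nseq m t).

Definition walk_weight (R : realType) (n : nat) (A : 'M[R]_n) (s : seq 'I_n) : R :=
  \prod_(p <- zip s (rot 1 s)) A p.1 p.2.

(* deletion of one (cyclic) backtracking pair of steps (x y)(y x) *)
Definition bt_step (n : nat) (s t : seq 'I_n) : Prop :=
  exists k : nat,
    (exists (x y : 'I_n) (rest : seq 'I_n), rot k s = [:: x, y, x & rest] /\ t = x :: rest)
    \/ (exists x y : 'I_n, rot k s = [:: x; y] /\ t = [::]).

Inductive bt_reduces (n : nat) : seq 'I_n -> seq 'I_n -> Prop :=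
  | bt_refl s : bt_reduces s s
  | bt_trans s t u : bt_step s t -> bt_reduces t u -> bt_reduces s u.

Definition totally_backtracking (n : nat) (s : seq 'I_n) : Prop :=
  bt_reduces s [::].

Definition orbit_of (n L : nat) (s : L.-tuple 'I_n) : {set L.-tuple 'I_n} :=
  [set [tuple of rot k s] | k : 'I_L].

Definition is_orbit (R : realType) (n L : nat) (A : 'M[R]_n)
  (O : {set L.-tuple 'I_n}) : Prop :=
  exists s : L.-tuple 'I_n, closed_walk A s /\ primitive A s /\ O = orbit_of s.

Definition orbit_rep (n L : nat) (O : {set L.-tuple 'I_n}) : seq 'I_n :=
  if [pick s in O] is Some s then val s else [::].

Definition orbit_weight (R : realType) (n L : nat) (A : 'M[R]_n)
  (O : {set L.-tuple 'I_n}) : R := walk_weight A (orbit_rep O).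

Definition orbit_totally_backtracking (n L : nat) (O : {set L.-tuple 'I_n}) : Prop :=
  totally_backtracking (orbit_rep O).

Definition tb_orbit_partial_prod (R : realType) (n : nat) (A : 'M[R]_n) (N : nat) : R :=
  \prod_(L < N)
    \prod_(O : {set L.-tuple 'I_n} |
             `[< is_orbit A O /\ orbit_totally_backtracking O >])
      (1 - orbit_weight A O)^-1.

(* Main.v *)
(** A closed walk is totally backtracking iff its lift to the universal cover of
    the graph is closed; vertices of the cover are reduced paths to a root,
    kept as stacks.  Let [w_ij(x)] be the generating series, for the matrix
    [x A], of the totally backtracking closed walks at [i] whose lift avoids a
    given neighbour over [j], and [w_ii] the unrestricted one.  The first-return
    decomposition [w_ij = 1 + x^2 sum_(k != j) r_ik^2 w_ki w_ij] makes
    [r_ij^2 w_ij(1)] the minimal nonnegative fixed point of the message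
    iteration, hence its limit [alpha_ij].

    On the one hand [Z^bp = prod_i w_ii * prod_(ij) (1 - x^2 r_ij^2 w_ij w_ji)]
    at [x = 1], and the logarithmic derivative of this function of [x] collapses
    to [x^-1 sum_i (w_ii - 1)]: the derivatives of the messages cancel, which is
    the stationarity of the Bethe free energy.  So [ln Z^bp = sum_k c_k / k] with
    [c_k] the total weight of the totally backtracking closed walks of length
    [k].  On the other hand every closed walk is a power of a unique primitive
    one, and the power is totally backtracking iff the root is (compare
    irreducible cores), so expanding [- ln (1 - R^l)] over the orbits [l] gives
    the same series.  Everything converges geometrically because [|A|] is
    symmetric, hence diagonalizable with eigenvalues of modulus [< 1]. *)

Require Import Defs.
From HB Require Import structures.
From mathcomp Require Import all_boot all_order all_algebra.
From mathcomp Require Import complex.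
From mathcomp Require Import ring lra zify.
From mathcomp Require Import all_classical all_reals all_analysis.
Import Order.TTheory GRing.Theory Num.Theory.
Import numFieldNormedType.Exports.
Local Open Scope classical_set_scope.
Local Open Scope ring_scope.
Set Implicit Arguments.
Unset Strict Implicit.

(** * Stack reduction of walks *)

Section Stack.
Local Open Scope nat_scope.
Context {T : eqType}.
Implicit Types (st s p : seq T) (v x y z : T).

(* A stack, top first, is the reduced path to the root in the universal cover. *)
Definition stack_step st v : seq T :=
  if st is _ :: y :: r then if v == y then y :: r else v :: st else v :: st.

Definition stack_run st p : seq T := foldl stack_step st p.

(** The closing step back to [x] is included, so the test says that the lift to the universal cover
    is closed. The empty word, where deletion of backtracking pairs ends, counts as trivial. *)
Definition trivial_walk s : bool :=
  if s is x :: s' then stack_run [:: x] (rcons s' x) == [:: x] else true.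

Fixpoint reduced s : bool :=
  if s is a :: s' then (if s' is _ :: c :: _ then a != c else true) && reduced s'
  else true.

Lemma stack_step_cons st v : exists r, stack_step st v = v :: r.
Proof.
case: st => [|a [|b r]] /=; try by eexists.
by case: (eqVneq v b) => [->|_]; eexists.
Qed.

Lemma reduced_step st v : reduced st -> reduced (stack_step st v).
Proof.
case: st => [|a [|b r]] //=.
case: ifP => [_ /andP[_ /andP[H1 H2]]|/negbT nvb H] /=; first by rewrite H1 H2.
by rewrite nvb /=.
Qed.

Lemma reduced_run st p : reduced st -> reduced (stack_run st p).
Proof. by elim: p st => //= v p IH st /reduced_step/IH. Qed.

Lemma reduced_suffix s p : reduced (p ++ s) -> reduced s.
Proof. by elim: p => //= a p IH /andP[_ /IH]. Qed.

Lemma reducedP x0 s :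
  reflect (forall i, (i.+2 < size s)%N -> nth x0 s i != nth x0 s i.+2) (reduced s).
Proof.
elim: s => [|a s IH] /=; first by apply: ReflectT.
apply: (iffP andP) => [[H1 /IH H2] [|i] Hi|H].
- by move: H1 Hi; case: (s) => [|b [|c r]].
- exact: H2.
split; last by apply/IH => i Hi; exact: (H i.+1).
by move: (H 0); case: (s) => [|b [|c r]] //=; apply.
Qed.

(** If [y] lies just below [x], the first step pops [x]. Reducedness says that [x] differs from the
    entry below [y], so the second step pushes [x] back instead of popping again. *)
Lemma stack_run_undo x y r : reduced (x :: r) -> stack_run (x :: r) [:: y; x] = x :: r.
Proof.
case: r => [|b r] /=; first by rewrite eqxx.
case: (eqVneq y b) => _; last by rewrite /= eqxx.
by case: r => [//|c r] /= /andP[/negbTE ->].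
Qed.

(** A pop would need a pattern [v a v]. Every intermediate stack is a suffix of the final one, whose
    reducedness excludes it. *)
Lemma stack_run_grow st p : reduced (catrev p st) -> stack_run st p = catrev p st.
Proof.
elim: p st => //= v p IH st Hr.
have /reduced_suffix: reduced (rev p ++ v :: st) by rewrite -catrevE.
case: st Hr => [|a [|b r]] //= Hr; try by rewrite IH.
by case/andP => /negbTE -> _; exact: IH.
Qed.

(* Action on stacks of moving the base vertex to its neighbour [z]. *)
Fixpoint rebase z st : seq T :=
  match st with
  | [::] => [::]
  | a :: st' =>
    match st' with
    | [::] => [:: a; z]
    | [:: b] => if a == z then [:: a] else [:: a; b; z]
    | _ => a :: rebase z st'
    end
  end.

(** Moving the root does not change adjacency in the cover. The cancellation that appending [z] may
    cause is confined to the bottom, so only short stacks need separate inspection. *)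
Lemma rebase_step z st v : st != [::] ->
  rebase z (stack_step st v) = stack_step (rebase z st) v.
Proof.
case: st => [//|a [|b [|c r]]] _ /=.
- by case: eqP => // ->.
- have [->|/negbTE naz] := eqVneq a z; have [->|/negbTE nvb] := eqVneq v b;
    by rewrite /= ?eqxx ?naz ?nvb.
- have [r' E] : exists r', rebase z [:: b, c & r] = b :: r'.
    by case: r => [|d r] /=; [case: ifP => _|]; eexists.
  rewrite -/(rebase z [:: b, c & r]) E.
  by case: (eqVneq v b) => _; rewrite /= -/(rebase z [:: b, c & r]) E.
Qed.

Lemma rebase_run z st p : st != [::] ->
  rebase z (stack_run st p) = stack_run (rebase z st) p.
Proof.
elim: p st => //= v p IH st Hst.
rewrite IH; first by rewrite rebase_step.
by have [r ->] := stack_step_cons st v.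
Qed.

(** Rebasing at the second vertex [y] turns the closed run from [[:: x]] into a run from [[:: x; y]]
    to itself. Its first step pops to [[:: y]], and the new closing step pops there again. *)
Lemma trivial_walk_rcons x s : trivial_walk (x :: s) -> trivial_walk (rcons s x).
Proof.
case: s => [//|y s] /= /eqP H.
have := @rebase_run y [:: x] (y :: rcons s x) isT.
rewrite [stack_run [:: x] _]H /= eqxx => E.
by rewrite {1}/stack_run foldl_rcons -/(stack_run _ _) -E /= eqxx.
Qed.

Lemma trivial_walk_rot k s : trivial_walk (rot k s) = trivial_walk s.
Proof.
have rot1 t : trivial_walk t -> trivial_walk (rot 1 t).
  by case: t => [//|x t] /trivial_walk_rcons; rewrite rot1_cons.
have rotk j t : (j <= size t)%N -> trivial_walk t -> trivial_walk (rot j t).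
  elim: j => [|j IH] Hj Ht; first by rewrite rot0.
  by rewrite -add1n rotD ?add1n //; apply/rot1/IH => //; exact: ltnW.
have [Hk|Hk] := leqP k (size s); last by rewrite rot_oversize // ltnW.
apply/idP/idP; last exact: rotk.
move/(@rotk (size s - k) _); rewrite size_rot leq_subr => /(_ isT).
suff -> : rot (size s - k) (rot k s) = s by [].
by rewrite -{1}(size_rot k s) -/(rotr k (rot k s)) rotK.
Qed.

Lemma stack_run_cat st p q : stack_run st (p ++ q) = stack_run (stack_run st p) q.
Proof. exact: foldl_cat. Qed.

Lemma cat_flatten_nseq (a b : seq T) m :
  a ++ flatten (nseq m (b ++ a)) = flatten (nseq m (a ++ b)) ++ a.
Proof. by elim: m => [|m IH] /=; rewrite ?cats0 // -!catA -IH !catA. Qed.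

Lemma rot_flatten_nseq k s m : (k <= size s)%N ->
  rot k (flatten (nseq m s)) = flatten (nseq m (rot k s)).
Proof.
move=> Hk; case: m => [//|m].
rewrite -{1}(cat_take_drop k s); set a := take k s; set b := drop k s.
have szk : size a = k by rewrite size_take_min (minn_idPl Hk).
have -> : rot k s = b ++ a by [].
by rewrite /= -catA -{1}szk rot_size_cat -!catA -cat_flatten_nseq.
Qed.

Lemma rcons_flatten_nseq x w m :
  rcons (w ++ flatten (nseq m (x :: w))) x = flatten (nseq m.+1 (rcons w x)).
Proof. by rewrite /= -!cats1 -catA -(cat1s x w) -cat_flatten_nseq catA. Qed.

Lemma trivial_walk_pow x w m :
  trivial_walk (flatten (nseq m.+1 (x :: w))) =
  (stack_run [:: x] (flatten (nseq m.+1 (rcons w x))) == [:: x]).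
Proof. by rewrite -rcons_flatten_nseq. Qed.

(** Each copy of the word ends at [x], so every copy starts with [x] on top of a reduced stack and
    its excursion to [y] is undone. *)
Lemma stack_run_pow_undo x y q m st : reduced (x :: st) ->
  stack_run (x :: st) (flatten (nseq m ([:: y; x] ++ rcons q x))) =
  stack_run (x :: st) (flatten (nseq m (rcons q x))).
Proof.
elim: m st => //= m IH st Hst.
rewrite -[LHS]/(stack_run (stack_run (x :: st) [:: y; x])
  (rcons q x ++ flatten (nseq m ([:: y; x] ++ rcons q x)))) stack_run_undo //.
rewrite !stack_run_cat.
have [r E] : exists r, stack_run (x :: st) (rcons q x) = x :: r.
  by rewrite /stack_run foldl_rcons; exact: stack_step_cons.
have Hr : reduced (x :: r) by rewrite -E; exact: reduced_run.
by rewrite E IH.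
Qed.

End Stack.

(** * Primitive roots of words *)

Section Periodicity.
Local Open Scope nat_scope.
Context {T : Type} (x0 : T).
Implicit Types (s t u : seq T).

Definition aperiodic t := forall m u, (1 < m)%N -> t <> flatten (nseq m u).

(** The infinite periodic sequence generated by [t]. Nonzero powers of a word generate the same
    sequence, so questions about roots become questions about periods. *)
Definition cyclic_nth t i := nth x0 t (i %% size t).

Lemma size_flatten_nseq m t : size (flatten (nseq m t)) = (m * size t)%N.
Proof. by elim: m => //= m IH; rewrite size_cat IH mulSn. Qed.

Lemma flatten_nseqM a b t :
  flatten (nseq a (flatten (nseq b t))) = flatten (nseq (a * b) t).
Proof. by elim: a => //= a IH; rewrite mulSn IH nseqD flatten_cat. Qed.

Lemma nth_flatten_nseq m t i : (i < m * size t)%N ->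
  nth x0 (flatten (nseq m t)) i = cyclic_nth t i.
Proof.
rewrite /cyclic_nth; elim: m i => [//|m IH] i; rewrite mulSn /= nth_cat.
have [Hi|Hi] := ltnP i (size t); first by rewrite modn_small.
rewrite -{1}(subnKC Hi) ltn_add2l => /IH ->.
by rewrite -{2}(subnKC Hi) modnDl.
Qed.

Lemma cyclic_nth_flatten m t : (0 < m)%N ->
  cyclic_nth (flatten (nseq m t)) =1 cyclic_nth t.
Proof.
move=> m0 i; case: (posnP (size t)) => [/size0nil -> | t0].
  have -> : flatten (nseq m [::]) = [::] :> seq T by elim: (m).
  by [].
rewrite {1}/cyclic_nth size_flatten_nseq nth_flatten_nseq; last first.
  by rewrite ltn_mod muln_gt0 m0.
by rewrite /cyclic_nth modn_dvdm // dvdn_mull.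
Qed.

Lemma cyclic_nth_rot k t i : (k <= size t)%N ->
  cyclic_nth (rot k t) i = cyclic_nth t (i + k).
Proof.
move=> Hk; case: (posnP (size t)) => [/size0nil -> | t0].
  by rewrite /cyclic_nth !nth_default ?size_rot.
rewrite /cyclic_nth size_rot /rot nth_cat size_drop -(modnDml i k).
have : (i %% size t < size t)%N by rewrite ltn_mod.
set j := (i %% size t)%N => Hj; case: ltnP => H.
  by rewrite nth_drop modn_small addnC // -ltn_subRL.
have Hjk : (size t <= j + k)%N by rewrite addnC -leq_subLR.
rewrite nth_take; last by lia.
rewrite -[(j + k)%N](subnK Hjk) modnDr modn_small ?subnBA //; lia.
Qed.

Lemma period_mul p (f : nat -> T) k i :
  (forall j, f (j + p)%N = f j) -> f (i + k * p)%N = f i.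
Proof. by move=> H; elim: k => [|k IH]; rewrite ?addn0 // mulSnr addnA H. Qed.

(** Bezout: [km * p = kn * q + gcdn p q], so a shift by the gcd followed by [kn] periods [q] amounts
    to [km] periods [p]. *)
Lemma period_gcd p q (f : nat -> T) : (0 < p)%N ->
  (forall j, f (j + p)%N = f j) -> (forall j, f (j + q)%N = f j) ->
  forall j, f (j + gcdn p q)%N = f j.
Proof.
move=> p0 Hp Hq j; case: (egcdnP q p0) => km kn E _.
by rewrite -(@period_mul q f kn (_ + _)) // -addnA (addnC (gcdn _ _)) -E period_mul.
Qed.

(** The gcd [g] of [p] and [size t] is again a period, so [t] is a power of its prefix of length
    [g]. Aperiodicity forces [g = size t]. *)
Lemma aperiodic_period t p : aperiodic t -> (0 < size t)%N -> (0 < p)%N ->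
  (forall j, cyclic_nth t (j + p) = cyclic_nth t j) -> (size t %| p)%N.
Proof.
move=> At t0 p0 Hp.
have Hg := period_gcd p0 Hp (fun j => congr1 (nth x0 t) (modnDr j (size t))).
set g := gcdn p (size t) in Hg; have g0 : (0 < g)%N by rewrite gcdn_gt0 p0.
have gt : (g %| size t)%N by rewrite dvdn_gcdr.
have szg : size (take g t) = g by rewrite size_takel // dvdn_leq.
suff E : t = flatten (nseq (size t %/ g) (take g t)).
  have [|H|H] := ltngtP (size t %/ g) 1; last 1 first.
  - by rewrite -[size t](divnK gt) H mul1n dvdn_gcdl.
  - by rewrite ltnS leqn0 -leqn0 leqNgt divn_gt0 // dvdn_leq.
  - by case: (At _ _ H E).
apply: (@eq_from_nth _ x0) => [|i Hi].
  by rewrite size_flatten_nseq szg divnK.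
rewrite nth_flatten_nseq ?szg ?divnK // /cyclic_nth szg nth_take ?ltn_mod //.
rewrite -{1}(modn_small Hi) -/(cyclic_nth t i) {1}(divn_eq i g) addnC period_mul //.
rewrite /cyclic_nth modn_small //; apply: leq_trans (dvdn_leq t0 gt).
by rewrite ltn_mod.
Qed.

Lemma aperiodic_root_unique t u : aperiodic t -> aperiodic u ->
  (0 < size t)%N -> (0 < size u)%N -> cyclic_nth t =1 cyclic_nth u -> t = u.
Proof.
move=> At Au t0 u0 E.
have sz : size t = size u.
  apply/eqP; rewrite eqn_dvd !aperiodic_period // => j.
    by rewrite -!E /cyclic_nth modnDr.
  by rewrite !E /cyclic_nth modnDr.
apply: (@eq_from_nth _ x0) => // i Hi.
by have := E i; rewrite /cyclic_nth -sz modn_small.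
Qed.

Lemma aperiodic_rot k t : (k <= size t)%N -> aperiodic t -> aperiodic (rot k t).
Proof.
move=> Hk At m u m1 E.
have szE : size t = (m * size u)%N by rewrite -size_flatten_nseq -E size_rot.
(* An empty [u] would make [t] empty, and the empty word is its own square. *)
case: (posnP (size u)) => [u0|u0].
  apply: (At 2 [::]) => //=; apply: size0nil; by rewrite szE u0 muln0.
have Eu i : cyclic_nth t (i + k) = cyclic_nth u i.
  by rewrite -cyclic_nth_rot // E cyclic_nth_flatten // ltnW.
have /dvdn_leq : (size t %| size u)%N.
  apply: aperiodic_period => // [|j]; first by rewrite szE muln_gt0 u0 ltnW.
  have shift i : cyclic_nth t i = cyclic_nth t (i + (size t - k) + k).
    by rewrite -addnA subnK // /cyclic_nth modnDr.
  rewrite shift (shift j) !Eu (addnAC j) /cyclic_nth; by rewrite modnDr.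
by move/(_ u0); rewrite szE leqNgt ltn_Pmull.
Qed.

(** Equal rotations would make [j - i] a period shorter than the word. *)
Lemma aperiodic_rot_inj i j t : aperiodic t -> (i < j < size t)%N ->
  rot i t <> rot j t.
Proof.
move=> At /andP[ij jt] E.
have it := ltn_trans ij jt.
have /dvdn_leq : (size t %| j - i)%N.
  apply: aperiodic_period => // [||n]; rewrite ?subn_gt0 //; first exact: leq_ltn_trans jt.
  have shift k : cyclic_nth t k = cyclic_nth t (k + (size t - i) + i).
    by rewrite -addnA subnK ?(ltnW it) // /cyclic_nth modnDr.
  rewrite [RHS]shift -(@cyclic_nth_rot i) ?(ltnW it) // E cyclic_nth_rot ?(ltnW jt) //.
  rewrite -addnA -[in RHS](subnK (ltnW ij)) (addnCA (size t - i)) subnK ?(ltnW it) //.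
  by rewrite addnA /cyclic_nth modnDr.
rewrite subn_gt0 => /(_ ij); rewrite leqNgt => /negP; apply.
by apply: leq_ltn_trans jt; exact: leq_subr.
Qed.

End Periodicity.

(** * Totally backtracking walks *)

Section Backtracking.
Context {R : realType} {n : nat}.
Implicit Types (A : 'M[R]_n) (s t : seq 'I_n).

Lemma closed_walk_rot A k s : closed_walk A (rot k s) = closed_walk A s.
Proof. by rewrite /closed_walk size_rot rot_cycle. Qed.

Lemma closed_walk_flatten A s m : (0 < m)%N ->
  closed_walk A (flatten (nseq m s)) = closed_walk A s.
Proof.
case: m => [//|m] _; case: s => [|x w]; first by rewrite /closed_walk size_flatten_nseq muln0.
rewrite /closed_walk /= rcons_flatten_nseq.
have lastE y : last y (rcons w x) = x by rewrite last_rcons.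
rewrite /= cat_path lastE; case E : (path _ _ _) => //=.
by elim: m => //= m IH; rewrite cat_path lastE IH E.
Qed.

Lemma bt_step_size s t : bt_step s t -> (size t < size s)%N.
Proof.
by case=> k [[x [y [r [E ->]]]]|[x [y [E ->]]]]; rewrite -(size_rot k s) E //=.
Qed.

Lemma bt_step_closed A s t : bt_step s t -> closed_walk A s ->
  t = [::] \/ closed_walk A t.
Proof.
case=> k [[x [y [r [E ->]]]]|[x [y [E ->]]]]; [right|by left].
by move: H; rewrite -(closed_walk_rot A k s) E /closed_walk /= => /and3P[].
Qed.

(** After a rotation the deleted pair sits at the front, and [stack_run_pow_undo] removes it from
    all [m] copies at once. *)
Lemma bt_step_trivial m s t : bt_step s t ->
  trivial_walk (flatten (nseq m s)) = trivial_walk (flatten (nseq m t)).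
Proof.
case: m => [//|m] [k]; wlog ks : k / (k <= size s)%N.
  move=> H; have [|/ltnW sk Hs] := leqP k (size s); first exact: H.
  by apply: (H 0%N) => //; rewrite rot0; rewrite rot_oversize in Hs.
rewrite -(@trivial_walk_rot _ k) rot_flatten_nseq //.
case=> [[x [y [r [-> ->]]]]|[x [y [-> ->]]]].
  by rewrite !trivial_walk_pow -(@stack_run_pow_undo _ x y r m.+1 [::]).
have -> : flatten (nseq m.+1 [::]) = [::] :> seq 'I_n by elim: (m).
rewrite trivial_walk_pow.
suff -> : stack_run [:: x] (flatten (nseq m.+1 (rcons [:: y] x))) = [:: x] by rewrite eqxx.
elim: m.+1 => //= j IH.
by rewrite /stack_run /= eqxx.
Qed.

Lemma tb_trivial m s : totally_backtracking s -> trivial_walk (flatten (nseq m s)).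
Proof.
rewrite /totally_backtracking; move E : [::] => u H.
elim: H E => [_ <-|{}s t {}u st _ IH /IH]; last by rewrite (bt_step_trivial m st).
by elim: (m).
Qed.

(** Length one would be a loop and length two a deletable pair. For longer words, entries two places
    apart differ cyclically, so the stack grows at every step and cannot return to height one. *)
Lemma irreducible_nontrivial A s m : irreflexive (adj A) -> closed_walk A s ->
  (forall t, ~ bt_step s t) -> (0 < m)%N -> ~~ trivial_walk (flatten (nseq m s)).
Proof.
move=> Airr; case: s => [//|x [|y [|z w]]] As Hs.
- by move: As; rewrite /closed_walk /= Airr.
- by case: (Hs [::]); exists 0%N; right; exists x, y; rewrite rot0.
case: m => [//|m] _; rewrite trivial_walk_pow.
set c := [:: x, y, z & w]; set p := flatten _.
have Ep : x :: p = rcons (flatten (nseq m.+1 c)) x by rewrite /p -rcons_flatten_nseq.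
have szp : size p = (m.+1 * size c)%N by rewrite size_flatten_nseq size_rcons.
have nth_p i : (i < size (x :: p))%N -> nth x (x :: p) i = cyclic_nth x c i.
  rewrite -[size (x :: p)]/((size p).+1) ltnS szp Ep nth_rcons size_flatten_nseq => Hi.
  case: ltnP => [H|H]; first by rewrite nth_flatten_nseq.
  have -> : i = (m.+1 * size c)%N by apply/eqP; rewrite eqn_leq Hi.
  by rewrite eqxx /cyclic_nth modnMl.
(* Otherwise rotating position [i] to the front would expose a pair that [bt_step] deletes. *)
have nobt i : cyclic_nth x c i != cyclic_nth x c i.+2.
  apply/eqP => E; pose j := (i %% size c)%N.
  have jc : (j <= size c)%N by rewrite ltnW // ltn_mod.
  have rotE k : cyclic_nth x (rot j c) k = cyclic_nth x c (i + k).
    by rewrite cyclic_nth_rot // /cyclic_nth addnC modnDml.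
  move: (rotE 0%N) (rotE 2%N) (size_rot j c) (Hs); rewrite addn0 addn2 -E.
  case Erot : (rot j c) => [|a [|b [|d r]]] // Ea Ed _ /(_ (a :: r)) [].
  exists j; left; exists a, b, r; split=> //; rewrite -/c Erot.
  have e0 : cyclic_nth x [:: a, b, d & r] 0 = a by rewrite /cyclic_nth mod0n.
  have e2 : cyclic_nth x [:: a, b, d & r] 2 = d by rewrite /cyclic_nth modn_small.
  by suff -> : d = a by []; rewrite -e2 Ed -Ea e0.
have Hred : reduced (rev (x :: p)).
  apply/(reducedP x) => i; rewrite size_rev => Hi.
  move: Hi (nth_p); set N := size (x :: p) => Hi nthN.
  rewrite !nth_rev -/N ?nthN; try lia.
  have -> : (N - i.+1 = (N - i.+3).+2)%N by lia.
  by rewrite eq_sym nobt.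
have Erev : rev (x :: p) = catrev p [:: x] by rewrite catrevE rev_cons cats1.
rewrite stack_run_grow -?Erev //; apply/eqP => /(congr1 size).
by rewrite size_rev -[size (x :: p)]/((size p).+1) szp.
Qed.

(* The irreducible core [c] of a walk satisfies [trivial (s^m) = trivial (c^m)], and
   a stack only grows along [c^m] when [c] is nonempty. *)
Lemma trivial_pow_tb A s m : irreflexive (adj A) -> closed_walk A s -> (0 < m)%N ->
  trivial_walk (flatten (nseq m s)) -> totally_backtracking s.
Proof.
move=> Airr + m0; have [k] := ubnP (size s).
elim: k s => // k IH s /ltnSE sk As Ht.
case: (pselect (exists t, bt_step s t)) => [[t st]|Hno]; last first.
  have := irreducible_nontrivial Airr As _ m0; rewrite Ht => H.
  by have /negP := H (fun t st => Hno (ex_intro _ t st)).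
apply: (bt_trans st); have [->|At] := bt_step_closed st As; first exact: bt_refl.
apply: IH => //; first exact: leq_trans (bt_step_size st) sk.
by rewrite -(bt_step_trivial m st).
Qed.

Lemma tb_powE A s m : irreflexive (adj A) -> closed_walk A s -> (0 < m)%N ->
  trivial_walk (flatten (nseq m s)) <-> totally_backtracking s.
Proof. by move=> Airr As m0; split; [exact: trivial_pow_tb|exact: tb_trivial]. Qed.
End Backtracking.

(** * Generating series of totally backtracking walks *)

Section WalkSeries.
Context {R : realType} {n : nat}.
Implicit Types (A B : 'M[R]_n) (i j k : 'I_n) (st : seq 'I_n).

(* [wpoly A t i j] tends coefficientwise to the generating series in [x] of the
   totally backtracking closed walks at [i], for the matrix [x A], whose lift to
   the universal cover avoids a fixed neighbour of the root lying over [j]. *)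
Fixpoint wpoly A (t : nat) i j : {poly R} :=
  if t is t'.+1 then
    1 + 'X^2 * \sum_(k | adj A i k && (k != j))
                  (A i k ^+ 2) *: (wpoly A t' k i * wpoly A t' i j)
  else 0.

(** The coefficient of degree [m] is final from stage [m.+1] on: see [wpoly_coef_stable]. *)
Definition wcoef A i j (m : nat) : R := (wpoly A m.+1 i j)`_m.

Lemma wpolyS_coef A t i j m :
  (wpoly A t.+1 i j)`_m = (m == 0%N)%:R +
    if (m < 2)%N then 0 else \sum_(k | adj A i k && (k != j))
       A i k ^+ 2 * (wpoly A t k i * wpoly A t i j)`_(m - 2).
Proof.
rewrite /= coefD coef1 coefXnM; case: ifP => // _; rewrite coef_sum.
by congr (_ + _); apply: eq_bigr => k _; rewrite coefZ.
Qed.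

Lemma ler_coefM (p p' q q' : {poly R}) m :
  (forall l, 0 <= p`_l <= p'`_l) -> (forall l, 0 <= q`_l <= q'`_l) ->
  0 <= (p * q)`_m <= (p' * q')`_m.
Proof.
move=> Hp Hq; rewrite !coefM; apply/andP; split.
  by apply: sumr_ge0 => l _; apply: mulr_ge0; [case/andP: (Hp l)|case/andP: (Hq (m - l)%N)].
apply: ler_sum => l _; have /andP[? ?] := Hp l; have /andP[? ?] := Hq (m - l)%N.
exact: ler_pM.
Qed.

Lemma wpoly_coef_mono A t i j m : 0 <= (wpoly A t i j)`_m <= (wpoly A t.+1 i j)`_m.
Proof.
elim: t i j m => [|t IH] i j m.
  rewrite coef0 lexx wpolyS_coef addr_ge0 //; case: ifP => // _.
  by rewrite big1 // => k _; rewrite mul0r coef0 mulr0.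
have H k := ler_coefM (m - 2) (IH k i) (IH i j).
rewrite !wpolyS_coef lerD2l; apply/andP; split.
  rewrite addr_ge0 //; case: ifP => // _; apply: sumr_ge0 => k _.
  by rewrite mulr_ge0 ?sqr_ge0 //; case/andP: (H k).
case: ifP => // _; apply: ler_sum => k _; rewrite ler_wpM2l ?sqr_ge0 //.
by case/andP: (H k).
Qed.

Lemma wpoly_coef_stable A t i j m : (m < t)%N ->
  (wpoly A t.+1 i j)`_m = (wpoly A t i j)`_m.
Proof.
elim: t i j m => [//|t IH] i j m Hm.
rewrite [LHS]wpolyS_coef [RHS]wpolyS_coef; congr (_ + _); case: ifP => // /negbT Hm2.
apply: eq_bigr => k _; congr (_ * _); rewrite !coefM; apply: eq_bigr => l _.
by rewrite !IH //; have := ltn_ord l; lia.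
Qed.

Lemma wpoly_wcoef A t i j m : (m < t)%N -> (wpoly A t i j)`_m = wcoef A i j m.
Proof.
elim: t => [//|t IH]; rewrite ltnS leq_eqVlt => /predU1P[->//|Hm].
by rewrite wpoly_coef_stable // IH.
Qed.

Lemma wpoly_le_wcoef A t i j m : (wpoly A t i j)`_m <= wcoef A i j m.
Proof.
have mono d : (wpoly A t i j)`_m <= (wpoly A (t + d) i j)`_m.
  elim: d => [|d IH]; rewrite ?addn0 // addnS (le_trans IH) //.
  by case/andP: (wpoly_coef_mono A (t + d) i j m).
by rewrite (le_trans (mono m.+1)) // wpoly_wcoef // addnS ltnS leq_addl.
Qed.

Lemma wcoef_ge0 A i j m : 0 <= wcoef A i j m.
Proof. by case/andP: (wpoly_coef_mono A m.+1 i j m). Qed.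

Lemma wcoef0 A i j : wcoef A i j 0 = 1.
Proof. by rewrite /wcoef wpolyS_coef addr0. Qed.

(** As [i] is not its own neighbour, the diagonal series runs over all neighbours and dominates the
    one that excludes [j]. *)
Lemma wcoef_le_diag A i j m : A i i = 0 -> wcoef A i j m <= wcoef A i i m.
Proof.
move=> Aii; rewrite /wcoef.
move: m.+1 => t; elim: t m => [|t IH] m; first by rewrite !coef0.
rewrite !wpolyS_coef lerD2l; case: ifP => // _.
have nn u a b l : 0 <= (wpoly A u a b)`_l by case/andP: (wpoly_coef_mono A u a b l).
have Hle k : 0 <= A i k ^+ 2 * (wpoly A t k i * wpoly A t i j)`_(m - 2) <=
        A i k ^+ 2 * (wpoly A t k i * wpoly A t i i)`_(m - 2).
  have Hp l : 0 <= (wpoly A t k i)`_l <= (wpoly A t k i)`_l by rewrite nn lexx.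
  have Hq l : 0 <= (wpoly A t i j)`_l <= (wpoly A t i i)`_l by rewrite nn IH.
  have /andP[H1 H2] := ler_coefM (m - 2) Hp Hq.
  by rewrite mulr_ge0 ?sqr_ge0 // ler_wpM2l ?sqr_ge0.
rewrite [leLHS]big_mkcond [leRHS]big_mkcond; apply: ler_sum => k _.
case: (eqVneq k i) => [->|_]; first by rewrite /adj Aii eqxx.
rewrite andbT; case: (adj A i k); rewrite ?andbF //= ; case: ifP => _.
  by case/andP: (Hle k).
by case/andP: (Hle k) => H1 H2; exact: le_trans H1 H2.
Qed.

(** The [m]-th power of the weighted adjacency operator of the universal cover, applied to [f] and
    evaluated at [st]. *)
Fixpoint stack_sum A x0 (f : seq 'I_n -> R) (m : nat) st : R :=
  if m is m'.+1 then \sum_v A (head x0 st) v * stack_sum A x0 f m' (stack_step st v)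
  else f st.

(* Green function of the universal cover, seen from a stack down to the root. *)
Fixpoint green A (W : 'I_n -> 'I_n -> {poly R}) st : {poly R} :=
  match st with
  | [::] => 0
  | a :: st' =>
    match st' with
    | [::] => W a a
    | b :: _ => A a b *: 'X * W a b * green A W st'
    end
  end.

Lemma coefM_low (p q : {poly R}) t m : (forall l, (l < t)%N -> p`_l = 0) ->
  (m < t)%N -> (p * q)`_m = 0.
Proof.
move=> Hp Hm; rewrite coefM big1 // => l _; rewrite Hp ?mul0r //.
by apply: leq_ltn_trans Hm; rewrite -ltnS.
Qed.

Lemma wpoly_low A t i j m : (m < t)%N ->
  (wpoly A t i j - (1 + 'X^2 * \sum_(k | adj A i k && (k != j))
     (A i k ^+ 2) *: (wpoly A t k i * wpoly A t i j)))`_m = 0.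
Proof.
by move=> Hm; rewrite coefB -[X in _ - X]/(wpoly A t.+1 i j)`_m wpoly_coef_stable ?subrr.
Qed.

(** Resolvent equation of the cover, with source at the root. The two sides differ by the defect [D]
    of the first-return equation, times the Green function further down the stack when the stack is
    not a single vertex; [D] vanishes below degree [t]. *)
Lemma green_step A t a st m : A^T = A -> (forall i, A i i = 0) -> (m < t)%N ->
  (green A (wpoly A t) (a :: st))`_m =
  ((nilp st)%:R + 'X * \sum_v A a v *: green A (wpoly A t) (stack_step (a :: st) v))`_m.
Proof.
move=> Asym Adiag Hm; have symE i j : A i j = A j i by rewrite -[in LHS]Asym mxE.
set W := wpoly A t; apply/eqP; rewrite -subr_eq0 -coefB; apply/eqP.
pose D b := W a b - (1 + 'X^2 * \sum_(k | adj A a k && (k != b))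
                                   (A a k ^+ 2) *: (W k a * W a b)).
have D0 b l : (l < t)%N -> (D b)`_l = 0 by exact: wpoly_low.
have sumE b (F : 'I_n -> {poly R}) : \sum_(v | v != b) A a v *: F v =
    \sum_(v | adj A a v && (v != b)) A a v *: F v.
  rewrite [RHS]big_mkcondl; apply: eq_bigr => v _; rewrite /adj.
  by case: eqP => //= ->; rewrite scale0r.
case: st => [|b r].
  rewrite -[RHS](D0 a m Hm); congr (nth 0 (polyseq _) m).
  rewrite /D -/W /=; congr (_ - (_ + _)).
  rewrite (bigD1 a) //= Adiag scale0r add0r sumE !mulr_sumr; apply: eq_bigr => k _.
  rewrite (symE k a) expr2 -!mul_polyC polyCM; ring.
rewrite -[RHS](coefM_low (A a b *: 'X * green A W (b :: r)) (D0 b) Hm).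
congr (nth 0 (polyseq _) m).
set G := green A W (b :: r); have Gab : green A W [:: a, b & r] = A a b *: 'X * W a b * G by [].
rewrite (bigD1 b) //= eqxx -/(green A W (b :: r)) -/G sumE.
rewrite [X in 'X * (_ + X)](_ : _ = \sum_(k | adj A a k && (k != b))
   (A a k ^+ 2) *: (W k a * W a b) * ('X * (A a b *: 'X * G))); last first.
  apply: eq_bigr => k /andP[_ /negbTE ->] /=; rewrite -/(green A W (b :: r)) -/G.
  rewrite (symE k a) expr2 -!mul_polyC polyCM; ring.
rewrite -mulr_suml /D -!mul_polyC; ring.
Qed.

(* Both sides solve the same linear recursion; [green_step] is exact up to [x^t]. *)
Lemma green_coef A t x0 st m : A^T = A -> (forall i, A i i = 0) -> (m < t)%N ->
  st != [::] -> last x0 st = x0 ->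
  (green A (wpoly A t) st)`_m = stack_sum A x0 (fun s => (s == [:: x0])%:R) m st.
Proof.
move=> Asym Adiag; elim: m st => [|m IH] [//|a st] Hm _ Hlast; rewrite green_step //.
  rewrite coefD coefXM addr0 coefMn coef1.
  case: st Hlast => [/= ->|b st _] /=; first by rewrite eqxx.
  by rewrite eqseq_cons andbF.
rewrite coefD coefXM coefMn coef1 mul0rn add0r [LHS]/= coef_sum.
apply: eq_bigr => v _; rewrite coefZ; congr (_ * _); apply: IH; first exact: ltnW.
  by case: (st) => [//|b r] /=; case: ifP.
by case: st Hlast => [|b r] /=; [|case: ifP].
Qed.

Lemma wcoef_diagE A i m : A^T = A -> (forall i, A i i = 0) ->
  wcoef A i i m = stack_sum A i (fun s => (s == [:: i])%:R) m [:: i].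
Proof. by move=> Asym Adiag; rewrite -(@green_coef A m.+1 i [:: i]). Qed.

(** Entry [i] of the [m]-th power of [A] applied to the all-ones vector. *)
Fixpoint row_power A (m : nat) i : R :=
  if m is m'.+1 then \sum_k A i k * row_power A m' k else 1.

Lemma stack_sum_le A x0 f m st : (forall s, `|f s| <= 1) ->
  `|stack_sum A x0 f m st| <= row_power (absmx A) m (head x0 st).
Proof.
move=> Hf; elim: m st => [|m IH] st //=; apply: le_trans (ler_norm_sum _ _ _) _.
apply: ler_sum => v _; rewrite normrM mxE ler_wpM2l //.
by apply: le_trans (IH _) _; have [r ->] := stack_step_cons st v.
Qed.

Lemma wcoef_le_row_power A i j m : A^T = A -> (forall i, A i i = 0) ->
  wcoef A i j m <= row_power (absmx A) m i.
Proof.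
move=> Asym Adiag; apply: le_trans (wcoef_le_diag _ _ (Adiag i)) _.
rewrite wcoef_diagE //; apply: le_trans (ler_norm _) _.
by apply: stack_sum_le => s; case: (_ == _); rewrite ?normr1 ?normr0.
Qed.

Fixpoint path_weight A i (p : seq 'I_n) : R :=
  if p is v :: p' then A i v * path_weight A v p' else 1.

Lemma big_tuple_cons m (F : seq 'I_n -> R) :
  \sum_(p : m.+1.-tuple 'I_n) F p = \sum_v \sum_(p : m.-tuple 'I_n) F (v :: p).
Proof.
rewrite pair_bigA /= (reindex (fun vp : 'I_n * m.-tuple 'I_n => [tuple of vp.1 :: vp.2])) //=.
exists (fun p => (thead p, [tuple of behead p])) => [[v p] _|p _] /=.
  by congr pair; apply: val_inj.
by rewrite [RHS]tuple_eta.
Qed.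

Lemma stack_sumE A x0 f m st :
  stack_sum A x0 f m st =
  \sum_(p : m.-tuple 'I_n) path_weight A (head x0 st) p * f (stack_run st p).
Proof.
elim: m st => [|m IH] st /=.
  rewrite (big_pred1 [tuple]) ?mul1r // => p; rewrite [p]tuple0; exact/esym/eqP.
rewrite (big_tuple_cons _ (fun p => path_weight A (head x0 st) p * f (stack_run st p))).
apply: eq_bigr => v _; rewrite IH mulr_sumr; apply: eq_bigr => p _ /=.
by rewrite mulrA; have [r ->] := stack_step_cons st v.
Qed.

Lemma row_powerE A m i : row_power A m i = \sum_(p : m.-tuple 'I_n) path_weight A i p.
Proof.
elim: m i => [|m IH] i /=.
  rewrite (big_pred1 [tuple]) // => p; rewrite [p]tuple0; exact/esym/eqP.
rewrite big_tuple_cons; apply: eq_bigr => v _; rewrite IH mulr_sumr.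
exact: eq_bigr.
Qed.

Lemma walk_weight_path A x s : walk_weight A (x :: s) = path_weight A x (rcons s x).
Proof.
rewrite /walk_weight rot1_cons; elim: s {1 3}x => [|y s IH] z /=.
  by rewrite big_cons big_nil.
by rewrite big_cons /= IH.
Qed.

Lemma sum_walk_weight A m (F : seq 'I_n -> R) :
  \sum_(s : m.+1.-tuple 'I_n) walk_weight A s * F s =
  \sum_i \sum_(s : m.-tuple 'I_n) path_weight A i (rcons s i) * F (i :: s).
Proof.
rewrite (big_tuple_cons _ (fun s => walk_weight A s * F s)); apply: eq_bigr => i _.
by apply: eq_bigr => s _; rewrite walk_weight_path.
Qed.

End WalkSeries.

(** * Geometric bounds *)

Section WalkBounds.
Context {R : realType} {n : nat}.
Implicit Types (A B : 'M[R]_n) (i j k : 'I_n).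

Lemma big_tuple_rcons m (F : seq 'I_n -> R) :
  \sum_(p : m.+1.-tuple 'I_n) F p = \sum_v \sum_(p : m.-tuple 'I_n) F (rcons p v).
Proof.
rewrite pair_bigA /=.
rewrite (reindex (fun vp : 'I_n * m.-tuple 'I_n => [tuple of rcons vp.2 vp.1])) //=.
exists (fun p : m.+1.-tuple 'I_n =>
    (last (thead p) p, [tuple of belast (thead p) (behead p)])) => [[v p] _|p _].
  congr pair => /=; first by rewrite last_rcons.
  by apply: val_inj; case: p => [[|a p] Hp] //=; rewrite belast_rcons.
apply: val_inj => /=; case/tupleP: p => a p /=.
by rewrite theadE -lastI.
Qed.

Lemma sum_wcoef_trivial A m : A^T = A -> (forall i, A i i = 0) ->
  \sum_i wcoef A i i m.+1 =
  \sum_(s : m.+1.-tuple 'I_n | trivial_walk s) walk_weight A s.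
Proof.
move=> Asym Adiag.
transitivity (\sum_(s : m.+1.-tuple 'I_n) walk_weight A s * (trivial_walk s)%:R); last first.
  rewrite [RHS]big_mkcond; apply: eq_bigr => s _.
  by case: trivial_walk; rewrite ?mulr1 ?mulr0.
rewrite (sum_walk_weight A m (fun s => (trivial_walk s)%:R)); apply: eq_bigr => i _.
rewrite wcoef_diagE // stack_sumE.
rewrite (big_tuple_rcons m (fun p => path_weight A i p * (stack_run [:: i] p == [:: i])%:R)).
(* The top of the final stack is the last vertex visited, so only paths ending at [i] contribute. *)
rewrite (bigD1 i) //= [X in _ + X]big1 ?addr0 // => v /negbTE vi.
apply: big1 => s _; rewrite /stack_run foldl_rcons.
by have [r ->] := stack_step_cons (foldl stack_step [:: i] s) v; rewrite eqseq_cons vi mulr0.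
Qed.

Lemma norm_walk_weight A s : `|walk_weight A s| = walk_weight (absmx A) s.
Proof. by rewrite /walk_weight normr_prod; apply: eq_bigr => p _; rewrite mxE. Qed.

Lemma path_weight_ge0 A i s : 0 <= path_weight (absmx A) i s.
Proof. by elim: s i => //= v s IH i; rewrite mulr_ge0 // mxE. Qed.

(** Closed walks at [i] are paths from [i] that end at [i]; admitting all endpoints only adds
    nonnegative terms. *)
Lemma sum_norm_walk_weight A m :
  \sum_(s : m.+1.-tuple 'I_n) `|walk_weight A s| <= \sum_i row_power (absmx A) m.+1 i.
Proof.
under eq_bigr do rewrite norm_walk_weight -[walk_weight _ _]mulr1.
rewrite (sum_walk_weight _ m (fun=> 1)); apply: ler_sum => i _.
rewrite row_powerE big_tuple_rcons (bigD1 i) //= ler_wpDr //.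
  by apply: sumr_ge0 => v _; apply: sumr_ge0 => s _; exact: path_weight_ge0.
by under eq_bigr do rewrite mulr1.
Qed.

Lemma row_power_geometric B : B^T = B -> spectral_radius_lt1 B ->
  exists C q : R, [/\ 0 <= C, 0 < q, q < 1 &
    forall m i, `|row_power B m i| <= C * q ^+ m].
Proof.
move=> Bsym Brho.
pose Bc : 'M[R[i]]_n := map_mx (real_complex R) B.
have Bherm : Bc \is symmetricmx.
  apply/is_hermitianmxP; rewrite expr0 scale1r.
  by apply/matrixP => i j; rewrite !mxE -[in LHS]Bsym mxE.
have Breal : Bc \is a mxOver Num.real.
  by apply/mxOverP => i j; rewrite mxE complex_real.
have /orthomx_spectralP := symmetric_normalmx Bherm Breal.
set P := spectralmx Bc; set d := spectral_diag Bc => BcE.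
have Punit : P \in unitmx by exact: spectral_unit.
have PBc : P *m Bc = diag_mx d *m P by rewrite {1}BcE !mulmxA mulmxV // mul1mx.
(* Row [j] of [P] is a left eigenvector for [d 0 j], nonzero because [P] is invertible. *)
have d_lt1 j : `|d 0 j| < 1.
  apply: Brho; apply/eigenvalueP; exists (row j P); last first.
    apply/eqP; rewrite rowE => /(congr1 (mulmx^~ (invmx P))); rewrite mulmxK // mul0mx.
    by move/matrixP/(_ 0 j); rewrite !mxE !eqxx => /eqP; rewrite oner_eq0.
  rewrite -/Bc -row_mul PBc; apply/rowP => k; rewrite [LHS]mxE mul_diag_mx !mxE.
  by [].
pose v m : 'cV[R[i]]_n := \col_i (row_power B m i)%:C%C.
have vS m : v m.+1 = Bc *m v m.
  apply/colP => i; rewrite !mxE rmorph_sum; apply: eq_bigr => k _.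
  by rewrite !mxE rmorphM.
have Pv m j : (P *m v m) j 0 = d 0 j ^+ m * (P *m v 0%N) j 0.
  elim: m => [|m IH]; first by rewrite mul1r.
  by rewrite vS mulmxA PBc -mulmxA mul_diag_mx mxE IH exprS mulrA.
have Re_norm (z : R[i]) : `|z| = (complex.Re `|z|)%:C%C by rewrite normc_def.
(* The default [2^-1] keeps the ratio strictly between 0 and 1 even if [n = 0] or all eigenvalues
   vanish. *)
pose q := \big[Num.max/2^-1]_j complex.Re `|d 0 j|.
have q_gt0 : 0 < q.
  by rewrite /q; elim/big_rec: _ => // j x _ x0; rewrite lt_max x0 orbT.
have dq j : complex.Re `|d 0 j| <= q by exact: le_bigmax.
pose c i j := complex.Re `|invmx P i j * (P *m v 0%N) j 0|.
have c_ge0 i j : 0 <= c i j by rewrite /c -lecR -Re_norm; exact: normr_ge0.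
exists (\sum_i \sum_j c i j), q; split=> //.
- by apply: sumr_ge0 => i _; apply: sumr_ge0.
- apply: bigmax_lt => [|j _]; first by rewrite invf_lt1 ?ltr1n.
  by rewrite -ltcR -Re_norm; exact: d_lt1.
move=> m i; apply: (@le_trans _ _ (\sum_j c i j * q ^+ m)); last first.
  rewrite -mulr_suml ler_wpM2r ?exprn_ge0 ?(ltW q_gt0) // [leRHS](bigD1 i) //= lerDl.
  by apply: sumr_ge0 => k _; apply: sumr_ge0.
have -> : `|row_power B m i| = complex.Re `|v m i 0|.
  by rewrite mxE normc_def /= expr0n /= addr0 sqrtr_sqr.
have -> : v m i 0 = \sum_j (invmx P i j * (P *m v 0%N) j 0) * d 0 j ^+ m.
  rewrite -[v m](mulKmx Punit) mxE; apply: eq_bigr => j _.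
  by rewrite (Pv m) mulrCA mulrC.
rewrite -lecR -Re_norm rmorph_sum; apply: le_trans (ler_norm_sum _ _ _) _.
apply: ler_sum => j _; rewrite normrM rmorphM rmorphXn normrX.
apply: ler_pM; rewrite ?exprn_ge0 ?normr_ge0 //.
have qC : `|d 0 j| <= q%:C%C by rewrite Re_norm lecR.
by rewrite lerXn2r // nnegrE (le_trans _ qC).
Qed.

End WalkBounds.

(** * Power series with geometrically bounded coefficients, and their derivatives *)

Section GeometricSeries.
Context {R : realType}.
Implicit Types (c : nat -> R) (x q C : R).

(** Each of the [m.+1] terms of [1 + r + ... + r ^+ m] is at least [r ^+ m], and this sum is below
    the full geometric series. *)
Lemma natr_expr_bound (r : R) m : 0 <= r -> r < 1 -> m.+1%:R * r ^+ m <= (1 - r)^-1.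
Proof.
move=> r0 r1; rewrite -[leRHS]mul1r ler_pdivlMr ?subr_gt0 //.
apply: (@le_trans _ _ (1 - r ^+ m.+1)); last by rewrite gerBl exprn_ge0.
rewrite -[1 in leRHS](expr1n _ m.+1) subrXX mulrC ler_wpM2l ?subr_ge0 ?(ltW r1) //.
rewrite -[m.+1 in leLHS]card_ord mulr_natl -sumr_const; apply: ler_sum => i _.
rewrite expr1n mul1r ler_wiXn2l ?(ltW r1) //.
by rewrite -ltnS.
Qed.

Definition geometric_bound c q := exists2 C, 0 <= C & forall m, `|c m| <= C * q ^+ m.

Lemma geometric_bound_cvg c q x : 0 <= q -> geometric_bound c q -> `|x| * q < 1 ->
  cvgn (pseries c x).
Proof.
move=> q0 [C C0 Hc] xq; apply: normed_cvg.
apply: (@series_le_cvg _ _ (geometric C (`|x| * q))) => [m|m|m|].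
- exact: normr_ge0.
- by rewrite /= mulr_ge0 // exprn_ge0 // mulr_ge0.
- by rewrite /= normrM normrX exprMn mulrCA mulrC ler_pM // mulrC.
- by apply: is_cvg_geometric_series; rewrite ger0_norm // mulr_ge0.
Qed.

(** The factor [m.+1] from differentiation is absorbed by the larger ratio, through
    [natr_expr_bound] at [q / r]. *)
Lemma geometric_bound_diffs c q r : 0 <= q -> q < r -> geometric_bound c q ->
  geometric_bound (pseries_diffs c) r.
Proof.
move=> q0 qr [C C0 Hc]; have r0 : 0 < r by exact: le_lt_trans qr.
have qr1 : q / r < 1 by rewrite ltr_pdivrMr // mul1r.
exists (C * q * (1 - q / r)^-1).
  by rewrite !mulr_ge0 // invr_ge0 subr_ge0 ltW.
move=> m; rewrite /pseries_diffs normrM ger0_norm //.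
apply: (@le_trans _ _ (m.+1%:R * (C * q ^+ m.+1))); first by rewrite ler_wpM2l.
have -> : m.+1%:R * (C * q ^+ m.+1) = C * q * (m.+1%:R * (q / r) ^+ m) * r ^+ m.
  by rewrite expr_div_n exprS; field; rewrite expf_neq0 // gt_eqF.
rewrite ler_wpM2r ?exprn_ge0 ?(ltW r0) // ler_wpM2l ?mulr_ge0 //.
by apply: natr_expr_bound => //; rewrite divr_ge0 // ltW.
Qed.

Lemma geometric_bound_le c q r : 0 <= q -> q <= r -> geometric_bound c q ->
  geometric_bound c r.
Proof.
move=> q0 qr [C C0 Hc]; exists C => // m; apply: le_trans (Hc m) _.
by rewrite ler_wpM2l // lerXn2r // nnegrE // (le_trans q0).
Qed.

Lemma geometric_bound_derive c q x : 0 <= q -> q < 1 -> geometric_bound c q -> `|x| <= 1 ->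
  is_derive x 1 (fun y => limn (pseries c y)) (limn (pseries (pseries_diffs c) x)).
Proof.
move=> q0 q1 Hc x1.
(* Termwise differentiation asks for convergence of the series and its first two derived series at
   some [K > 1]. Each differentiation costs one enlargement of the ratio, and
   [q < q' < q'' < K^-1 < 1]. *)
pose q' := (q + 1) / 2; pose q'' := (q' + 1) / 2; pose K := ((q'' + 1) / 2)^-1.
have [Hq' Hq'' HK] : [/\ q < q', q' < q'' & q'' < K^-1] by rewrite /K invrK /q'' /q'; split; lra.
have K1 : K^-1 < 1 by rewrite /K invrK /q'' /q'; lra.
have K0 : 0 < K by rewrite -invr_gt0; lra.
have bd d : geometric_bound d q'' -> cvgn (pseries d K).
  move=> Hd; apply: (@geometric_bound_cvg _ q'') => //; first by lra.
  by rewrite gtr0_norm // mulrC -ltr_pdivlMr // div1r.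
have Hd : geometric_bound (pseries_diffs c) q' by exact: geometric_bound_diffs Hc.
apply: (@pseries_snd_diffs _ c K); try apply: bd.
- by apply: geometric_bound_le Hc => //; lra.
- by apply: geometric_bound_le Hd; lra.
- by apply: geometric_bound_diffs Hd => //; lra.
- rewrite (le_lt_trans x1) // gtr0_norm //.
  by rewrite -[K]invrK invf_gt1 // invr_gt0.
Qed.

Lemma is_derive_bigsum (I : Type) (r : seq I) (P : pred I) (f : I -> R -> R) (df : I -> R) x :
  (forall i, P i -> is_derive x 1 (f i) (df i)) ->
  is_derive x 1 (fun y => \sum_(i <- r | P i) f i y) (\sum_(i <- r | P i) df i).
Proof.
move=> H; elim: r => [|i r IH].
  rewrite big_nil (_ : (fun _ => _) = cst 0); first exact: is_derive_cst.
  by apply/funext => y; rewrite big_nil.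
rewrite big_cons; case: ifP => Pi; last first.
  rewrite (_ : (fun y => _) = fun y => \sum_(j <- r | P j) f j y) //.
  by apply/funext => y; rewrite big_cons Pi.
rewrite (_ : (fun y => _) = f i + (fun y => \sum_(j <- r | P j) f j y)).
  by apply: is_deriveD; exact: H.
by apply/funext => y; rewrite big_cons Pi.
Qed.

Lemma is_derive_sqrM (c : R) (g : R -> R) (dg x : R) : is_derive x 1 g dg ->
  is_derive x 1 (fun y => y ^+ 2 * (c * g y)) (c * (2 * x * g x + x ^+ 2 * dg)).
Proof.
move=> Hg; have := is_deriveM (is_deriveX 2 (is_derive_id x (1 : R))) (is_deriveZ c Hg).
rewrite (_ : _ * _ = fun y => y ^+ 2 * (c * g y)); last exact/funext.
move=> H; apply: (is_derive_eq H); rewrite /GRing.scale /=.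
by rewrite -[LHS]/(x ^+ 2 * (c * dg) + c * g x * (2 * x ^+ 1 * 1)); ring.
Qed.

End GeometricSeries.

(** * Messages and the Bethe free energy *)

Section MessageSeries.
Context {R : realType} {n : nat} (A : 'M[R]_n) (q : R).
Hypotheses (Adiag : forall i, A i i = 0) (q_ge0 : 0 <= q) (q_lt1 : q < 1).
Hypothesis diag_bound : forall i, geometric_bound (wcoef A i i) q.
Implicit Types (i j k : 'I_n) (x : R).

Definition wgf i j x : R := limn (pseries (wcoef A i j) x).

Lemma wcoef_bound i j : geometric_bound (wcoef A i j) q.
Proof.
have [C C0 HC] := diag_bound i; exists C => // m; apply: le_trans (HC m).
by rewrite !ger0_norm ?wcoef_ge0 // wcoef_le_diag.
Qed.

Lemma wgf_is_cvg i j x : `|x| <= 1 -> cvgn (pseries (wcoef A i j) x).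
Proof.
move=> x1; apply: (geometric_bound_cvg q_ge0 (wcoef_bound i j)).
by apply: le_lt_trans q_lt1; rewrite ler_piMl.
Qed.

Lemma pseries_le_wpoly t i j x : 0 <= x ->
  pseries (wcoef A i j) x t <= (wpoly A t i j).[x].
Proof.
move=> x0; set p := wpoly A t i j.
rewrite (@horner_coef_wide _ (t + size p)) ?leq_addl // /pseries /series /=.
rewrite big_mkord big_split_ord /= -[leLHS]addr0 lerD //.
  by apply: ler_sum => m _; rewrite wpoly_wcoef.
apply: sumr_ge0 => m _; rewrite mulr_ge0 ?exprn_ge0 //.
by case/andP: (wpoly_coef_mono A t i j (t + m)).
Qed.

Lemma wpoly_le_wgf t i j x : 0 <= x <= 1 -> (wpoly A t i j).[x] <= wgf i j x.
Proof.
case/andP=> x0 x1; set p := wpoly A t i j.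
apply: (@le_trans _ _ (pseries (wcoef A i j) x (size p))).
  rewrite horner_coef /pseries /series /= big_mkord.
  by apply: ler_sum => m _; rewrite ler_wpM2r ?exprn_ge0 // wpoly_le_wcoef.
apply: nondecreasing_cvgn_le; last by apply: wgf_is_cvg; rewrite ger0_norm.
by apply: nondecreasing_series => m _ _; rewrite mulr_ge0 ?wcoef_ge0 ?exprn_ge0.
Qed.

(** Squeezed between the partial sums of the full series and its limit. *)
Lemma wpoly_cvg i j x : 0 <= x <= 1 ->
  (wpoly A t i j).[x] @[t --> \oo] --> wgf i j x.
Proof.
move=> x01; have /andP[x0 x1] := x01.
apply: (@squeeze_cvgr _ _ _ _ (pseries (wcoef A i j) x) (cst (wgf i j x))).
- by near=> t; rewrite pseries_le_wpoly // wpoly_le_wgf.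
- by apply: wgf_is_cvg; rewrite ger0_norm.
- exact: cvg_cst.
Unshelve. all: by end_near. Qed.

Lemma wgf_eq i j x : 0 <= x <= 1 ->
  wgf i j x = 1 + x ^+ 2 * \sum_(k | adj A i k && (k != j))
                             A i k ^+ 2 * (wgf k i x * wgf i j x).
Proof.
move=> x01; have H : (wpoly A t.+1 i j).[x] @[t --> \oo] --> wgf i j x.
  by have := @wpoly_cvg i j x x01; rewrite -cvg_shiftS.
apply: (cvg_unique (@Rhausdorff R) H).
have -> : (fun t => (wpoly A t.+1 i j).[x]) = fun t => 1 + x ^+ 2 *
    \sum_(k | adj A i k && (k != j)) A i k ^+ 2 * ((wpoly A t k i).[x] * (wpoly A t i j).[x]).
  apply/funext => t; rewrite /= hornerD hornerM hornerXn hornerC horner_sum.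
  by congr (_ + _ * _); apply: eq_bigr => k _; rewrite hornerZ hornerM.
apply: cvgD; first exact: cvg_cst.
apply: cvgMl_tmp; apply: cvg_big => [|k _].
  exact: add_continuous.
by apply: cvgMl_tmp; apply: cvgM; exact: wpoly_cvg.
Qed.

Lemma wgf_ge1 i j x : 0 <= x <= 1 -> 1 <= wgf i j x.
Proof.
move=> x01; apply: le_trans (wpoly_le_wgf 1 i j x01).
by rewrite /= big1 ?mulr0 ?addr0 ?hornerC // => k _; rewrite scaler0.
Qed.

Lemma wgf_gt0 i j x : 0 <= x <= 1 -> 0 < wgf i j x.
Proof. by move/(wgf_ge1 i j); apply: lt_le_trans. Qed.

(** The first-return equation divided by [wgf i j x]; at [x = 1] it has the shape of the denominator
    in the message update. *)
Lemma wgfV i j x : 0 <= x <= 1 ->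
  (wgf i j x)^-1 = 1 - x ^+ 2 * \sum_(k | adj A i k && (k != j)) A i k ^+ 2 * wgf k i x.
Proof.
move=> x01; have w0 : wgf i j x != 0 by rewrite gt_eqF ?wgf_gt0.
have E : wgf i j x = 1 + x ^+ 2 *
    ((\sum_(k | adj A i k && (k != j)) A i k ^+ 2 * wgf k i x) * wgf i j x).
  rewrite [LHS]wgf_eq // mulr_suml; congr (_ + _ * _).
  by apply: eq_bigr => k _; rewrite mulrA.
apply: (mulIf w0); rewrite mulVf // mulrBl mul1r.
by move: E; set S := \sum_(_ | _) _; move: (wgf i j x) => w E; lra.
Qed.

Hypothesis Asym : A^T = A.

Let symE i j : A i j = A j i. Proof. by rewrite -[in LHS]Asym mxE. Qed.

(** The update is increasing in the incoming messages, and by [wgfV] the upper bound is a fixed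
    point; the denominators stay above the positive [(wgf i j 1)^-1]. *)
Lemma alpha_iter_le t i j : 0 <= alpha_iter A t i j <= A i j ^+ 2 * wgf i j 1.
Proof.
have x01 : 0 <= (1 : R) <= 1 by rewrite ler01 lexx.
elim: t i j => [|t IH] i j /=; first by
  rewrite lexx /= mulr_ge0 ?sqr_ge0 //; exact: ltW (wgf_gt0 _ _ x01).
have H : (wgf i j 1)^-1 <= 1 - \sum_(k | adj A i k && (k != j)) alpha_iter A t k i.
  rewrite wgfV // expr1n mul1r lerB // ler_sum // => k _.
  by rewrite (symE i k); case/andP: (IH k i).
have H0 : 0 < 1 - \sum_(k | adj A i k && (k != j)) alpha_iter A t k i.
  by rewrite (lt_le_trans _ H) // invr_gt0 wgf_gt0.
rewrite divr_ge0 ?sqr_ge0 ?(ltW H0) //= ler_wpM2l ?sqr_ge0 //.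
by rewrite -[leRHS]invrK lef_pV2 // posrE invr_gt0 wgf_gt0.
Qed.

(** One inequality is the limit of [alpha_iter_le]. For the other, the inverses of the limiting
    denominators [D] solve the first-return equation at 1, hence dominate every iterate [wpoly]
    started from 0, and so its limit. *)
Lemma alpha_fixpointE (alpha : 'I_n -> 'I_n -> R) i j :
  (forall k i, alpha_iter A t k i @[t --> \oo] --> alpha k i) ->
  alpha i j = A i j ^+ 2 * wgf i j 1.
Proof.
move=> Halpha; have x01 : 0 <= (1 : R) <= 1 by rewrite ler01 lexx.
have alpha_le k l : 0 <= alpha k l <= A k l ^+ 2 * wgf k l 1.
  apply/andP; split.
    apply: (cvgr_to_ge (Halpha k l)).
    by near=> t; case/andP: (alpha_iter_le t k l).
  apply: (cvgr_to_le (Halpha k l)).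
  by near=> t; case/andP: (alpha_iter_le t k l).
pose D k l := 1 - \sum_(m | adj A k m && (m != l)) alpha m k.
have D_ge k l : (wgf k l 1)^-1 <= D k l.
  rewrite wgfV // expr1n mul1r lerB // ler_sum // => m _.
  by rewrite (symE k m); case/andP: (alpha_le m k).
have D_gt0 k l : 0 < D k l by rewrite (lt_le_trans _ (D_ge k l)) // invr_gt0 wgf_gt0.
have alphaE k l : alpha k l = A k l ^+ 2 / D k l.
  have Hkl : alpha_iter A t.+1 k l @[t --> \oo] --> alpha k l.
    by have := Halpha k l; rewrite -cvg_shiftS.
  apply: (cvg_unique (@Rhausdorff R) Hkl).
  apply: cvgMl_tmp; apply: cvgV; first by rewrite gt_eqF.
  apply: cvgB; first exact: cvg_cst.
  apply: cvg_big => [|m _]; first exact: add_continuous.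
  exact: Halpha.
have DE k l : (D k l)^-1 =
    1 + \sum_(m | adj A k m && (m != l)) A k m ^+ 2 * ((D m k)^-1 * (D k l)^-1).
  have D0 : D k l != 0 by rewrite gt_eqF.
  apply: (mulIf D0).
  rewrite mulVf ?gt_eqF // mulrDl mul1r mulr_suml.
  rewrite -[LHS](subrK (\sum_(m | adj A k m && (m != l)) alpha m k)).
  congr (_ + _); apply: eq_bigr => m _.
  by rewrite alphaE (symE k m) -!mulrA mulVf ?gt_eqF // mulr1.
have wpoly_le t k l : (wpoly A t k l).[1] <= (D k l)^-1.
  elim: t k l => [|t IH] k l; first by rewrite horner0 invr_ge0 ltW.
  rewrite /= hornerD hornerM hornerXn hornerC horner_sum expr1n mul1r DE lerD2l.
  apply: ler_sum => m _; rewrite hornerZ hornerM ler_wpM2l ?sqr_ge0 //.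
  have nn a b : 0 <= (wpoly A t a b).[1].
    rewrite horner_coef; apply: sumr_ge0 => c _; rewrite expr1n mulr1.
    by case/andP: (wpoly_coef_mono A t a b c).
  exact: ler_pM.
rewrite alphaE; congr (_ * _); apply/eqP; rewrite eq_le; apply/andP; split.
  by rewrite -[leRHS]invrK lef_pV2 // posrE ?invr_gt0 ?wgf_gt0.
apply: (cvgr_to_le (@wpoly_cvg i j 1 x01)).
by near=> t.
Unshelve. all: by end_near. Qed.

Lemma is_derive_wgf i j x : `|x| <= 1 ->
  is_derive x 1 (wgf i j) (limn (pseries (pseries_diffs (wcoef A i j)) x)).
Proof. exact: (geometric_bound_derive q_ge0 q_lt1 (wcoef_bound i j)). Qed.

(* [log_coef 0 = 0] since [0^-1 = 0]. *)
Definition log_coef (m : nat) : R := (\sum_i wcoef A i i m) / m%:R.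

Definition log_series x : R := limn (pseries log_coef x).

Lemma log_coef_bound : geometric_bound log_coef q.
Proof.
have /choice[C HC] : forall i, exists C, 0 <= C /\ forall m, `|wcoef A i i m| <= C * q ^+ m.
  by move=> i; have [C C0 HC] := diag_bound i; exists C.
exists (\sum_i C i) => [|m]; first by apply: sumr_ge0 => i _; case: (HC i).
rewrite normrM mulr_suml; apply: (@le_trans _ _ (`|\sum_i wcoef A i i m| * 1)).
  rewrite ler_wpM2l // normfV normr_nat.
  by case: m => [|m]; rewrite ?invr0 // invf_le1 ?ltr0n // ler1n.
rewrite mulr1; apply: le_trans (ler_norm_sum _ _ _) _; apply: ler_sum => i _.
by case: (HC i).
Qed.

(** Differentiation cancels the division by [m]; the missing constant term is [wcoef A i i 0 = 1],
    whence the subtraction. *)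
Lemma log_series_diffs x : `|x| <= 1 ->
  x * limn (pseries (pseries_diffs log_coef) x) = \sum_i (wgf i i x - 1).
Proof.
move=> x1; pose D := pseries (pseries_diffs log_coef) x.
have Dcvg : cvgn D.
  have [r [r1 qr]] : exists r : R, r < 1 /\ q < r.
    by exists ((q + 1) / 2); move: q_lt1 => ?; split; lra.
  have r0 : 0 <= r by exact: le_trans (ltW qr).
  apply: (geometric_bound_cvg r0 (geometric_bound_diffs q_ge0 qr log_coef_bound)).
  by apply: le_lt_trans r1; rewrite ler_piMl.
have H1 : x * D N @[N --> \oo] --> x * limn D by exact: cvgMl_tmp.
apply: (cvg_unique (@Rhausdorff R) H1).
have -> : (fun N => x * D N) = fun N => \sum_i (pseries (wcoef A i i) x N.+1 - 1).
  apply/funext => N; rewrite /D /pseries /series /= big_mkord mulr_sumr.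
  under [RHS]eq_bigr => i _ do rewrite big_mkord big_ord_recl wcoef0 expr0 mulr1 addrC addKr.
  rewrite exchange_big /=; apply: eq_bigr => m _.
  rewrite /pseries_diffs /log_coef [m.+1%:R * _]mulrC mulfVK ?pnatr_eq0 // mulr_suml mulr_sumr.
  by apply: eq_bigr => i _; rewrite exprS mulrCA.
apply: cvg_big => [|i _]; first exact: add_continuous.
apply: cvgB; last exact: cvg_cst.
by have := @wgf_is_cvg i i x x1; rewrite -cvg_shiftS.
Qed.

Lemma adj_sym i j : adj A i j = adj A j i.
Proof. by rewrite /adj symE. Qed.

Lemma adj_neq i j : adj A i j -> j != i.
Proof. by apply: contraTneq => ->; rewrite /adj Adiag eqxx. Qed.

Lemma big_edges (F : 'I_n -> 'I_n -> R) :
  \sum_i \sum_(k | adj A i k && (k != i)) F i k =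
  \sum_(p : 'I_n * 'I_n | (p.1 < p.2)%N && adj A p.1 p.2) (F p.1 p.2 + F p.2 p.1).
Proof.
rewrite pair_big_dep /= big_split /=.
rewrite [X in _ = _ + X](reindex_inj (h := fun p : 'I_n * 'I_n => (p.2, p.1))) /=; last first.
  by move=> [a b] [c d] [-> ->].
rewrite (bigID (fun p : 'I_n * 'I_n => (p.1 < p.2)%N)) /=; congr (_ + _).
  apply: eq_bigl => -[a b] /=; case: (ltnP a b) => ab; rewrite ?andbF ?andbT //=.
  by case adjab: (adj A a b) => //=; apply: adj_neq.
apply: eq_big => [[a b]|[a b] _] //=; rewrite (adj_sym b a) andbC.
case adjab: (adj A a b) => /=; last by rewrite !andbF.
rewrite (adj_neq adjab) !andbT -leqNgt leq_eqVlt.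
by have /negbTE := adj_neq adjab; rewrite -val_eqE /= => ->.
Qed.

(** At [x = 1], on an edge, this is the ratio of the edge term to its two vertex terms in the
    belief-propagation estimate. *)
Definition edge_factor i j x := 1 - x ^+ 2 * (A i j ^+ 2 * (wgf i j x * wgf j i x)).

(** By [wgfV] the inverses of [wgf i i x] and [wgf i j x] differ exactly by the term [k = j]. *)
Lemma edge_factorE i j x : 0 <= x <= 1 -> adj A i j ->
  wgf i j x = edge_factor i j x * wgf i i x.
Proof.
move=> x01 Aij; have wi0 : wgf i i x != 0 by rewrite gt_eqF ?wgf_gt0.
have wij0 : wgf i j x != 0 by rewrite gt_eqF ?wgf_gt0.
have E : (wgf i i x)^-1 = (wgf i j x)^-1 - x ^+ 2 * (A i j ^+ 2 * wgf j i x).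
  rewrite !wgfV // (bigD1 j) /=; last by rewrite Aij adj_neq.
  rewrite mulrDr opprD addrCA addrC; congr (_ - _ * _ - _).
  apply: eq_bigl => k; case Aik : (adj A i k) => //=.
  by rewrite (adj_neq Aik).
apply: (mulIf (invr_neq0 wi0)); rewrite mulfK // E /edge_factor mulrBr divff //.
ring.
Qed.

Lemma edge_factor_gt0 i j x : 0 <= x <= 1 -> adj A i j -> 0 < edge_factor i j x.
Proof.
move=> x01 Aij; rewrite -(pmulr_lgt0 _ (wgf_gt0 i i x01)) -edge_factorE //.
exact: wgf_gt0.
Qed.

(** Equal to [(wgf i i x)^-1] on the unit interval. In this form its derivative involves the edge
    series [wgf k i], as that of the edge factors does. *)
Definition node_factor i x :=
  1 - x ^+ 2 * \sum_(k | adj A i k && (k != i)) A i k ^+ 2 * wgf k i x.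

Definition free_energy x :=
  - (\sum_i ln (node_factor i x))
  + (\sum_(p : 'I_n * 'I_n | (p.1 < p.2)%N && adj A p.1 p.2) ln (edge_factor p.1 p.2 x))
  - log_series x.

(** The factor [x] comes from [log_series_diffs]. It makes the derivative vanish for [x > 0], which
    suffices for the mean value theorem on the unit interval. *)
Lemma is_derive_free_energy x : 0 <= x <= 1 ->
  exists2 d, x * d = 0 & is_derive x 1 free_energy d.
Proof.
move=> x01; have x1 : `|x| <= 1 by case/andP: x01 => x0; rewrite ger0_norm.
have dw i j := @is_derive_wgf i j x x1.
set dW := fun i j => limn (pseries (pseries_diffs (wcoef A i j)) x) in dw.
have dS : is_derive x 1 log_series _ := geometric_bound_derive q_ge0 q_lt1 log_coef_bound x1.
pose F i k := wgf i i x * (A i k ^+ 2 * (2 * x * wgf k i x + x ^+ 2 * dW k i)).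
pose G i j := - ((edge_factor i j x)^-1 * (A i j ^+ 2 * (2 * x * (wgf i j x * wgf j i x)
    + x ^+ 2 * (dW i j * wgf j i x + wgf i j x * dW j i)))).
have dnode i : is_derive x 1 (fun y => ln (node_factor i y))
    (- \sum_(k | adj A i k && (k != i)) F i k).
  have nfE : node_factor i x = (wgf i i x)^-1 by rewrite wgfV.
  have nf_gt0 : 0 < node_factor i x by rewrite nfE invr_gt0 wgf_gt0.
  have dN : is_derive x 1 (node_factor i)
      (0 - \sum_(k | adj A i k && (k != i)) A i k ^+ 2 * (2 * x * wgf k i x + x ^+ 2 * dW k i)).
    rewrite (_ : node_factor i = cst 1 -
      (fun y => \sum_(k | adj A i k && (k != i)) y ^+ 2 * (A i k ^+ 2 * wgf k i y))).
      apply: is_deriveB; apply: is_derive_bigsum => k _; exact: is_derive_sqrM.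
    by apply/funext => y; rewrite /node_factor mulr_sumr.
  apply: is_derive_eq (is_derive1_comp (is_derive1_ln nf_gt0) dN) _.
  by rewrite nfE invrK sub0r mulrN mulr_sumr.
have dedge i j : adj A i j -> is_derive x 1 (fun y => ln (edge_factor i j y)) (G i j).
  move=> Aij; have dE : is_derive x 1 (edge_factor i j) (0 - A i j ^+ 2 *
      (2 * x * (wgf i j x * wgf j i x) + x ^+ 2 * (dW i j * wgf j i x + wgf i j x * dW j i))).
    rewrite (_ : edge_factor i j = cst 1 -
      (fun y => y ^+ 2 * (A i j ^+ 2 * (wgf i j * wgf j i) y))) //.
    apply: is_deriveB; apply: is_derive_sqrM.
    apply: is_derive_eq (is_deriveM (dw i j) (dw j i)) _.
    by rewrite /GRing.scale /= addrC mulrC.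
  apply: is_derive_eq (is_derive1_comp (is_derive1_ln (edge_factor_gt0 x01 Aij)) dE) _.
  by rewrite sub0r mulrN.
exists (- (\sum_i - \sum_(k | adj A i k && (k != i)) F i k)
   + (\sum_(p : 'I_n * 'I_n | (p.1 < p.2)%N && adj A p.1 p.2) G p.1 p.2)
   - limn (pseries (pseries_diffs log_coef) x)); last first.
  apply: is_deriveB; apply: is_deriveD; first apply: is_deriveN.
    exact: is_derive_bigsum.
  by apply: is_derive_bigsum => p /andP[_ /dedge].
rewrite mulrBr log_series_diffs // sumrN opprK.
have -> : \sum_i (wgf i i x - 1) =
    \sum_i \sum_(k | adj A i k && (k != i)) x ^+ 2 * (A i k ^+ 2 * (wgf k i x * wgf i i x)).
  apply: eq_bigr => i _; rewrite {1}wgf_eq // addrC addKr mulr_sumr.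
  by [].
rewrite !big_edges mulrDr !mulr_sumr -big_split -sumrB /=.
apply: big1 => -[i j] /= /andP[_ Aij].
have Aji : adj A j i by rewrite adj_sym.
have uE : edge_factor j i x = edge_factor i j x.
  by rewrite /edge_factor symE (mulrC (wgf j i x)).
have u0 : edge_factor i j x != 0 by rewrite gt_eqF ?edge_factor_gt0.
(* Edge by edge, [wgf i j x = u * wgf i i x] makes the [dW] terms of vertices and edge cancel; the
   explicit powers of [x] left over match the two terms of the logarithmic series. *)
rewrite /F /G (symE j i) (edge_factorE x01 Aij) (edge_factorE x01 Aji) uE.
move: (edge_factor i j x) u0 => u u0; field.
exact: u0.
Qed.

Lemma free_energy_const : free_energy 1 = free_energy 0.
Proof.
have x01 (x : R) : x \in `[0, 1] -> 0 <= x <= 1 by rewrite in_itv.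
have [c c01] : exists2 c, c \in `[0 : R, 1] & free_energy 1 - free_energy 0 = 0 * (1 - 0).
  apply: (@MVT_segment _ free_energy (fun=> 0) 0 1 ler01) => [x x01o|].
    have /andP[x0 x1] : 0 < x < 1 by rewrite in_itv in x01o.
    have [|d xd dL] := @is_derive_free_energy x; first by rewrite !ltW.
    by move/eqP: xd; rewrite mulf_eq0 (gt_eqF x0) => /eqP d0; rewrite -d0.
  apply: derivable_within_continuous => x /x01 H.
  by have [d _ []] := is_derive_free_energy H.
by rewrite mul0r => /eqP; rewrite subr_eq0 => /eqP.
Qed.

Lemma free_energy0 : free_energy 0 = 0.
Proof.
rewrite /free_energy big1 => [|i _]; last by rewrite /node_factor expr0n mul0r subr0 ln1.
rewrite big1 => [|p _]; last by rewrite /edge_factor expr0n mul0r subr0 ln1.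
rewrite oppr0 addr0 sub0r /log_series; apply/eqP; rewrite oppr_eq0; apply/eqP.
rewrite (_ : pseries _ _ = cst 0); first exact: lim_cst.
apply/funext => N; rewrite /pseries /series /= big1 // => -[|m] _.
  by rewrite /log_coef invr0 mulr0 mul0r.
by rewrite expr0n mulr0.
Qed.

Lemma exp_log_series1 : expR (log_series 1) =
  (\prod_i (node_factor i 1)^-1) *
  \prod_(p : 'I_n * 'I_n | (p.1 < p.2)%N && adj A p.1 p.2) edge_factor p.1 p.2 1.
Proof.
have x01 : 0 <= (1 : R) <= 1 by rewrite ler01 lexx.
have := free_energy_const; rewrite free_energy0 => /eqP; rewrite subr_eq0 => /eqP <-.
rewrite expRD -sumrN !expR_sum; congr (_ * _).
  apply: eq_bigr => i _; rewrite expRN lnK // posrE.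
  by rewrite (_ : node_factor i 1 = (wgf i i 1)^-1) ?invr_gt0 ?wgf_gt0 ?wgfV.
by apply: eq_bigr => p /andP[_ Ap]; rewrite lnK // posrE edge_factor_gt0.
Qed.

Lemma Z_bpE (alpha : 'I_n -> 'I_n -> R) :
  (forall k i, alpha_iter A t k i @[t --> \oo] --> alpha k i) ->
  Z_bp A alpha = expR (log_series 1).
Proof.
move=> Halpha; have x01 : 0 <= (1 : R) <= 1 by rewrite ler01 lexx.
have alphaE k l : alpha k l = A l k ^+ 2 * wgf k l 1 by rewrite symE; exact: alpha_fixpointE.
have ZiE i : Zi_bp A alpha i = wgf i i 1.
  rewrite -[RHS]invrK wgfV // expr1n mul1r; congr (1 - _)^-1.
  by apply: eq_big => [k|k _]; [case Aik: (adj A i k); rewrite //= adj_neq|exact: alphaE].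
have exceptE i j : 1 - alpha_except A alpha i j = (wgf i j 1)^-1.
  by rewrite wgfV // expr1n mul1r; congr (1 - _); apply: eq_bigr => k _; exact: alphaE.
rewrite exp_log_series1; congr (_ * _).
  by apply: eq_bigr => i _; rewrite ZiE -[LHS]invrK wgfV.
apply: eq_bigr => -[i j] /= /andP[_ Aij].
have Aji : adj A j i by rewrite adj_sym.
have wi0 : wgf i i 1 != 0 by rewrite gt_eqF ?wgf_gt0.
have wj0 : wgf j j 1 != 0 by rewrite gt_eqF ?wgf_gt0.
have u0 : edge_factor i j 1 != 0 by rewrite gt_eqF ?edge_factor_gt0.
have uE : edge_factor j i 1 = edge_factor i j 1.
  by rewrite /edge_factor symE (mulrC (wgf j i 1)).
have wij := edge_factorE x01 Aij; have wji := edge_factorE x01 Aji; rewrite uE in wji.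
have uD : edge_factor i j 1 = 1 - A i j ^+ 2 * (wgf i j 1 * wgf j i 1).
  by rewrite {1}/edge_factor expr1n mul1r.
have wij0 : wgf i j 1 != 0 by rewrite gt_eqF ?wgf_gt0.
have wji0 : wgf j i 1 != 0 by rewrite gt_eqF ?wgf_gt0.
(* The determinant is [(wgf i j 1 * wgf j i 1)^-1 - A i j ^+ 2], that is, the edge factor over
   [wgf i j 1 * wgf j i 1]. *)
have ZijE : Zij_bp A alpha i j = wgf i j 1 * wgf j i 1 / edge_factor i j 1.
  rewrite /Zij_bp !exceptE mulrNN -expr2 uD -[RHS]invrK; congr (_^-1).
  rewrite invf_div; field; exact/andP.
rewrite ZijE !ZiE wij wji; field.
by rewrite wj0 wi0 u0.
Qed.

End MessageSeries.

(** * Orbits *)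

Section Orbits.
Context {R : realType} {n : nat} (A : 'M[R]_n).
Hypothesis Adiag : forall i, A i i = 0.
Implicit Types (s t u : seq 'I_n) (m L k : nat).

Let adj_irr : irreflexive (adj A). Proof. by move=> i; rewrite /adj Adiag eqxx. Qed.

Lemma path_weight_cat i s t :
  path_weight A i (s ++ t) = path_weight A i s * path_weight A (last i s) t.
Proof. by elim: s i => [|v s IH] i; rewrite /= ?mul1r // IH mulrA. Qed.

Lemma walk_weight_pow m t : (0 < m)%N ->
  walk_weight A (flatten (nseq m t)) = walk_weight A t ^+ m.
Proof.
case: m => [//|m] _; case: t => [|x w].
  have -> : flatten (nseq m.+1 [::]) = [::] :> seq 'I_n by elim: (m).
  by rewrite /walk_weight big_nil expr1n.
rewrite walk_weight_path [flatten _]/= walk_weight_path rcons_flatten_nseq.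
elim: m.+1 => //= j IH; rewrite path_weight_cat last_rcons IH exprS.
by [].
Qed.

Lemma walk_weight_rot k t : walk_weight A (rot k t) = walk_weight A t.
Proof.
have rot1 s : walk_weight A (rot 1 s) = walk_weight A s.
  case: s => [//|x [//|y w]]; rewrite rot1_cons rcons_cons !walk_weight_path.
  by rewrite -[in LHS]cats1 path_weight_cat last_rcons /= mulr1 mulrC.
have [kt|/ltnW kt] := leqP k (size t); last by rewrite rot_oversize.
by elim: k kt => [|k IH] kt; rewrite ?rot0 // -add1n rotD // rot1 IH // ltnW.
Qed.

(** Allows sums over closed walks to range over all tuples. *)
Lemma walk_weight_closed t : (0 < size t)%N -> walk_weight A t != 0 -> closed_walk A t.
Proof.
case: t => [//|x w] _; rewrite walk_weight_path /closed_walk /=.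
elim: (rcons w x) {1 3}x => //= v p IH y; rewrite mulf_eq0 negb_or => /andP[Hyv /IH ->].
by rewrite andbT.
Qed.

(** A word whose power is a closed walk is itself a closed walk. *)
Lemma primitiveP t : closed_walk A t -> primitive A t <-> aperiodic t.
Proof.
move=> At; split=> [Hp m u m1 E|Hp [m [u [m1 [_ E]]]]]; last exact: Hp E.
apply: Hp; exists m, u; split=> //; split=> //.
by rewrite -(@closed_walk_flatten _ _ A u m (ltnW m1)) -E.
Qed.

Lemma aperiodic_root t : (0 < size t)%N ->
  exists m u, [/\ (0 < m)%N, aperiodic u & t = flatten (nseq m u)].
Proof.
have [k] := ubnP (size t); elim: k t => // k IH t /ltnSE tk t0.
case: (pselect (aperiodic t)) => [At|/existsNP[m /existsNP[u /not_implyP[m1 /contrapT E]]]].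
  by exists 1%N, t; rewrite /= cats0.
have szE : size t = (m * size u)%N by rewrite E size_flatten_nseq.
have u0 : (0 < size u)%N by move: t0; rewrite szE muln_gt0 => /andP[].
have [|//|m' [u' [m'0 Au' Eu]]] := IH u.
  by apply: leq_trans tk; rewrite szE ltn_Pmull.
exists (m * m')%N, u'; split=> //; first by rewrite muln_gt0 m'0 ltnW.
by rewrite E Eu flatten_nseqM.
Qed.

Definition primitive_tb t : bool :=
  `[< closed_walk A t /\ primitive A t /\ totally_backtracking t >].

Lemma primitive_tbP t : reflect [/\ closed_walk A t, aperiodic t & trivial_walk t] (primitive_tb t).
Proof.
have flat1 : flatten (nseq 1 t) = t by rewrite /= cats0.
apply: (iffP (asboolP _)) => [[At [/(primitiveP At) Ap /(tb_powE adj_irr At (ltn0Sn 0))]]|[At Ap Ht]].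
  by rewrite flat1.
split=> //; split; first exact/(primitiveP At).
by apply/(tb_powE adj_irr At (ltn0Sn 0)); rewrite flat1.
Qed.

Lemma primitive_tb_rot k t : (k <= size t)%N -> primitive_tb t -> primitive_tb (rot k t).
Proof.
move=> kt /primitive_tbP[At Ap Ht]; apply/primitive_tbP; split.
- by rewrite closed_walk_rot.
- by case: t kt Ap {At Ht} => [|x w] // kt Ap; exact: (aperiodic_rot x).
- by rewrite trivial_walk_rot.
Qed.

Lemma trivial_walk_powE m t : (0 < m)%N -> closed_walk A t ->
  trivial_walk (flatten (nseq m t)) = trivial_walk t.
Proof.
move=> m0 At; have E := tb_powE adj_irr At.
have flat1 : flatten (nseq 1 t) = t by rewrite /= cats0.
apply/idP/idP => [/(E m m0)/(E 1%N isT)|]; first by rewrite flat1.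
by rewrite -{1}flat1 => /(E 1%N isT)/(E m m0).
Qed.

(** A closed walk is a power of a unique aperiodic word, trivial exactly when the walk is; [L] is
    the length of this root. Exchanging the sums leaves, for each [s], a sum over its roots. *)
Lemma sum_trivial_walk_roots k : (0 < k)%N ->
  \sum_(s : k.-tuple 'I_n | trivial_walk s) walk_weight A s =
  \sum_(L < k.+1 | (0 < L)%N && (L %| k)%N)
     \sum_(t : L.-tuple 'I_n | primitive_tb t) walk_weight A t ^+ (k %/ L).
Proof.
move=> k0.
have kL (L : 'I_k.+1) : (0 < L)%N && (L %| k)%N -> (0 < k %/ L)%N.
  by case/andP=> L0 Lk; rewrite divn_gt0 // dvdn_leq.
transitivity (\sum_(L < k.+1 | (0 < L)%N && (L %| k)%N)
     \sum_(t : L.-tuple 'I_n | primitive_tb t)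
       \sum_(s : k.-tuple 'I_n | val s == flatten (nseq (k %/ L) (val t))) walk_weight A s); last first.
  apply: eq_bigr => L HL; apply: eq_bigr => t _.
  have szt : size (flatten (nseq (k %/ L) (val t))) == k.
    by rewrite size_flatten_nseq size_tuple divnK //; case/andP: HL.
  by rewrite (big_pred1 (Tuple szt)) ?walk_weight_pow ?kL.
under [RHS]eq_bigr => L HL do rewrite (exchange_big_dep xpredT) //=.
rewrite (exchange_big_dep xpredT) //= [LHS]big_mkcond; apply: eq_bigr => s _.
have sz : size s = k by rewrite size_tuple.
have [ws0|ws0] := eqVneq (walk_weight A s) 0.
  rewrite ws0 if_same big1 // => L _; exact: big1.
have As : closed_walk A s by apply: walk_weight_closed; rewrite ?sz.
have [m [u [m0 Au Eu]]] : exists m u, [/\ (0 < m)%N, aperiodic u & val s = flatten (nseq m u)].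
  by apply: aperiodic_root; rewrite sz.
have clu : closed_walk A u by rewrite -(@closed_walk_flatten _ _ A u m m0) -Eu.
have szu : k = (m * size u)%N by rewrite -sz {1}Eu size_flatten_nseq.
have u0 : (0 < size u)%N by case/andP: clu.
have triv : trivial_walk s = trivial_walk u by rewrite Eu trivial_walk_powE.
have unique (L : 'I_k.+1) (t : L.-tuple 'I_n) : (0 < L)%N && (L %| k)%N -> primitive_tb t ->
    val s = flatten (nseq (k %/ L) (val t)) -> val t = u.
  move=> HL /primitive_tbP[At Ap Ht] E.
  have [x0 _] : exists x0, x0 \in u by move: u0; case: (u) => // x w; exists x; exact: mem_head.
  apply: (@aperiodic_root_unique _ x0) => //; first by rewrite size_tuple; case/andP: HL.
  by move=> i; rewrite -(cyclic_nth_flatten x0 _ (kL L HL)) -E Eu cyclic_nth_flatten.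
case: ifP => Ht; last first.
  rewrite big1 // => L; rewrite andbT => HL; apply: big1 => t /andP[tp /eqP E].
  have /primitive_tbP[_ _ Htr] := tp; move: Htr.
  by rewrite (unique L t HL tp E) -triv Ht.
have Lk : (size u < k.+1)%N by rewrite ltnS szu leq_pmull.
rewrite (bigD1 (Ordinal Lk)) /=; last by rewrite u0 szu dvdn_mull.
rewrite (big_pred1 (in_tuple u)) => [|t] /=; last first.
  apply/idP/eqP => [/andP[tp /eqP E]|->].
    apply: val_inj => /=; apply: (unique (Ordinal Lk)) => //=.
    by rewrite u0 szu dvdn_mull.
  rewrite /= {2}szu mulnK // -Eu eqxx andbT.
  by apply/primitive_tbP; rewrite -triv.
rewrite big1 ?addr0 // => L; rewrite andbT => /andP[HL LneqL0]; apply: big1 => t /andP[tp /eqP E].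
by case/eqP: LneqL0; apply: val_inj; rewrite /= -(unique L t HL tp E) size_tuple.
Qed.

Definition tb_orbit L (O : {set L.-tuple 'I_n}) : bool :=
  `[< is_orbit A O /\ orbit_totally_backtracking O >].

Lemma mem_orbit_of L (s t : L.-tuple 'I_n) : (0 < L)%N ->
  reflect (exists2 k, (k <= L)%N & val t = rot k s) (t \in orbit_of s).
Proof.
move=> L0; apply: (iffP imsetP) => [[k _ ->]|[k kL E]]; first by exists k => //; exact: ltnW.
case: (ltngtP k L) kL => // [kL _|kL _]; first by exists (Ordinal kL) => //; exact: val_inj.
exists (Ordinal L0) => //; apply: val_inj; rewrite E kL /= rot0.
by rewrite -{1}(size_tuple s) rot_size.
Qed.

Lemma orbit_of_rot L (s t : L.-tuple 'I_n) k : (0 < L)%N -> (k <= L)%N ->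
  val t = rot k s -> orbit_of t = orbit_of s.
Proof.
move=> L0.
have sub (s' t' : L.-tuple 'I_n) j : (j <= L)%N -> val t' = rot j s' -> orbit_of t' \subset orbit_of s'.
  move=> jL E; apply/fintype.subsetP => u /(mem_orbit_of _ _ L0)[i iL Eu].
  apply/(mem_orbit_of _ _ L0); rewrite Eu E rot_add_mod ?size_tuple //.
  by case: ifP => H; [exists (i + j)%N|exists (i + j - L)%N] => //; lia.
move=> kL E; apply/eqP; rewrite finset.eqEsubset (sub s t k) //=.
apply: (sub t s (L - k)%N); first exact: leq_subr.
by rewrite E -[L in (L - k)%N](size_tuple s) -{1}(size_rot k s) -/(rotr k _) rotK.
Qed.

Lemma orbit_rep_mem L (O : {set L.-tuple 'I_n}) (t : L.-tuple 'I_n) : t \in O ->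
  exists2 u, u \in O & orbit_rep O = val u.
Proof.
by rewrite /orbit_rep; case: pickP => [u uO _|->] //; exists u.
Qed.

Lemma tb_orbitP L (O : {set L.-tuple 'I_n}) : (0 < L)%N ->
  reflect (exists2 s : L.-tuple 'I_n, primitive_tb s & O = orbit_of s) (tb_orbit O).
Proof.
move=> L0; have self (s : L.-tuple 'I_n) : s \in orbit_of s.
  by apply/mem_orbit_of => //; exists 0%N; rewrite ?rot0.
have tbE (s : L.-tuple 'I_n) : closed_walk A s ->
    orbit_totally_backtracking (orbit_of s) <-> trivial_walk s.
  move=> As; rewrite /orbit_totally_backtracking.
  have [u /(mem_orbit_of _ _ L0)[k kL Eu] ->] := orbit_rep_mem (self s).
  rewrite -(trivial_walk_rot k) -Eu.
  have Au : closed_walk A u by rewrite Eu closed_walk_rot.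
  by have := tb_powE adj_irr Au (ltn0Sn 0); rewrite /= cats0 => H; split=> /H.
apply: (iffP (asboolP _)) => [[[s [As [Ap ->]]] /(tbE s As) Ht]|[s sp ->]].
  by exists s => //; apply/primitive_tbP; split=> //; exact/(primitiveP As).
have /primitive_tbP[As Ap Ht] := sp; split; last exact/(tbE s As).
by exists s; split=> //; split=> //; exact/(primitiveP As).
Qed.

(** An aperiodic word has [L] distinct rotations, so each orbit is counted [L] times. *)
Lemma sum_tb_orbits L (f : seq 'I_n -> R) : (0 < L)%N ->
  (forall k t, f (rot k t) = f t) ->
  \sum_(t : L.-tuple 'I_n | primitive_tb t) f t =
  L%:R * \sum_(O : {set L.-tuple 'I_n} | tb_orbit O) f (orbit_rep O).
Proof.
move=> L0 frot; rewrite (partition_big (@orbit_of n L) (@tb_orbit L)) /=; last first.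
  by move=> t tp; apply/tb_orbitP => //; exists t.
rewrite mulr_sumr; apply: eq_bigr => O /(tb_orbitP _ L0)[s sp EO].
have sO : s \in O by rewrite EO; apply/mem_orbit_of => //; exists 0%N; rewrite ?rot0.
have [u uO ->] := orbit_rep_mem sO.
have inO (t : L.-tuple 'I_n) : t \in O -> f t = f s.
  by rewrite EO => /(mem_orbit_of _ _ L0)[k _ ->].
transitivity (\sum_(t in O) f u).
  apply: eq_big => [t|t /andP[_ /eqP EtO]]; last first.
    rewrite (inO u uO) inO // -EtO; apply/mem_orbit_of => //; by exists 0%N; rewrite ?rot0.
  apply/andP/idP => [[_ /eqP <-]|].
    by apply/mem_orbit_of => //; exists 0%N; rewrite ?rot0.
  rewrite EO => /(mem_orbit_of _ _ L0)[k kL Et]; split; last exact/eqP/(orbit_of_rot L0 kL Et).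
  by rewrite Et primitive_tb_rot // size_tuple.
rewrite sumr_const EO card_in_imset ?card_ord ?mulr_natl // => i j _ _ /(congr1 val) /= E.
have /primitive_tbP[_ Ap _] := sp.
have s0 : (0 < size s)%N by rewrite size_tuple.
have [x0 _] : exists x0, x0 \in tval s.
  by move: s0; case: (tval s) => // x w _; exists x; exact: mem_head.
apply: val_inj => /=; case: (ltngtP i j) => // ij; exfalso.
  by apply: (aperiodic_rot_inj x0 Ap) E; rewrite ij size_tuple /=.
by apply: (aperiodic_rot_inj x0 Ap) (esym E); rewrite ij size_tuple /=.
Qed.

Definition orbit_power_sum L m : R :=
  \sum_(O : {set L.-tuple 'I_n} | tb_orbit O) orbit_weight A O ^+ m.

(** The multiplicity [L] of an orbit turns [1 / k] into [1 / (k / L)], the coefficient of the power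
    [k / L] in [- ln (1 - z)]. *)
Lemma sum_trivial_walk_orbits k : (0 < k)%N ->
  (\sum_(s : k.-tuple 'I_n | trivial_walk s) walk_weight A s) / k%:R =
  \sum_(L < k.+1 | (0 < L)%N && (L %| k)%N)
     orbit_power_sum L (k %/ L) / (k %/ L)%:R.
Proof.
move=> k0; rewrite sum_trivial_walk_roots // mulr_suml.
apply: eq_bigr => L /andP[L0 Lk].
rewrite (@sum_tb_orbits L (fun t => walk_weight A t ^+ (k %/ L))) //; last first.
  by move=> j t; rewrite walk_weight_rot.
rewrite -[X in _ / X%:R](divnK Lk) natrM.
have d0 : (k %/ L)%:R != 0 :> R by rewrite pnatr_eq0 -lt0n divn_gt0 // dvdn_leq.
have L0' : (L : nat)%:R != 0 :> R by rewrite pnatr_eq0 -lt0n.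
rewrite /orbit_power_sum /orbit_weight; field.
by rewrite d0 L0'.
Qed.

(** The [m]-th powers of distinct words of length [L] are distinct words of length [m * L], the
    first block recovering the word. *)
Lemma orbit_power_sum_le L m : (0 < L)%N -> (0 < m)%N ->
  \sum_(O : {set L.-tuple 'I_n} | tb_orbit O) `|orbit_weight A O| ^+ m <=
  \sum_(s : (m * L).-tuple 'I_n) `|walk_weight A s|.
Proof.
move=> L0 m0.
set S := leLHS; have S0 : 0 <= S by apply: sumr_ge0 => O _; rewrite exprn_ge0.
apply: (@le_trans _ _ (L%:R * S)); first by rewrite ler_peMl // ler1n.
rewrite /S /orbit_weight -(@sum_tb_orbits L (fun t => `|walk_weight A t| ^+ m)) //; last first.
  by move=> j t; rewrite walk_weight_rot.
have szp (t : L.-tuple 'I_n) : size (flatten (nseq m (val t))) == (m * L)%N.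
  by rewrite size_flatten_nseq size_tuple.
pose h (t : L.-tuple 'I_n) := Tuple (szp t).
have hinj : injective h.
  move=> t u /(congr1 val) /= E; apply: val_inj.
  case: m m0 E {S S0 szp h} => [//|m] _ /= /eqP.
  by rewrite eqseq_cat ?size_tuple // => /andP[/eqP].
under eq_bigr => t _ do rewrite -normrX -walk_weight_pow // -[flatten _]/(val (h t)).
rewrite -(big_imset (fun s : (m * L).-tuple 'I_n => `|walk_weight A s|)); last first.
  by move=> ? ? _ _; exact: hinj.
by rewrite big_mkcond; apply: ler_sum => s _; case: ifP.
Qed.

End Orbits.

(** * Convergence of the orbit product *)

Section LogSeries.
Context {R : realType}.
Implicit Types (u : R^nat) (C q x : R).

Lemma expR_log_series x : `|x| < 1 ->
  (1 - x)^-1 = expR (limn (pseries (fun m => m%:R^-1) x)).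
Proof.
(* Scaling [x] into the coefficients moves the expansion point to [1], inside the
   disk of convergence. *)
move=> x1; pose c (m : nat) := m%:R^-1 * x ^+ m : R.
have c_bound : geometric_bound c `|x|.
  exists 1 => // m; rewrite normrM normrX mul1r ler_piMl ?exprn_ge0 // normfV normr_nat.
  by case: m => [|m]; rewrite ?invr0 // invf_le1 ?ltr0n // ler1n.
have pos (y : R) : 0 <= y <= 1 -> 0 < 1 - x * y.
  case/andP=> y0 y1; rewrite subr_gt0; apply: le_lt_trans x1; apply: le_trans (ler_norm _) _.
  by rewrite normrM ler_piMr // ger0_norm.
pose f y := limn (pseries c y) + ln (1 - x * y).
have df (y : R) : 0 <= y <= 1 -> is_derive y 1 f 0.
  move=> y01; have /andP[y0 y1] := y01.
  have y1' : `|y| <= 1 by rewrite ger0_norm.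
  have D1 := geometric_bound_derive (normr_ge0 x) x1 c_bound y1'.
  have E1 : limn (pseries (pseries_diffs c) y) = x * (1 - x * y)^-1.
    apply: cvg_lim; first exact: Rhausdorff.
    rewrite (_ : pseries _ _ = series (geometric x (x * y))).
      apply: cvg_geometric_series; rewrite normrM; apply: le_lt_trans x1.
      by rewrite ler_piMr.
    rewrite /pseries; congr series; apply/funext => m /=.
    by rewrite /pseries_diffs /c mulrA mulfV ?pnatr_eq0 // mul1r exprMn exprS mulrA.
  have D2 : is_derive y 1 (fun z => 1 - x * z) (0 - x * 1).
    rewrite (_ : (fun z => _) = cst 1 - x \*: id); last by apply/funext.
    exact: is_deriveB.
  have D3 := @is_derive1_comp R _ (fun z => 1 - x * z) y _ _ (is_derive1_ln (pos y y01)) D2.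
  apply: is_derive_eq (is_deriveD D1 D3) _.
  by rewrite E1 sub0r mulr1 mulrN mulrC subrr.
have [d d01] : exists2 d, d \in `[0 : R, 1] & f 1 - f 0 = 0 * (1 - 0).
  apply: (@MVT_segment _ f (fun=> 0) 0 1 ler01) => [y|].
    by rewrite in_itv => /andP[y0 y1]; apply: df; rewrite !ltW.
  apply: derivable_within_continuous => y; rewrite in_itv /= => y01.
  by have [] := df y y01.
rewrite mul0r => /eqP; rewrite subr_eq0 /f mulr1 mulr0 subr0 ln1 addr0 => /eqP E.
have c0 : limn (pseries c 0) = 0.
  rewrite (_ : pseries _ _ = cst 0); first exact: lim_cst.
  apply/funext => N; rewrite /pseries /series /= big1 // => -[|m] _.
    by rewrite /c invr0 !mul0r.
  by rewrite expr0n mulr0.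
have c1 : pseries c 1 = pseries (fun m => m%:R^-1) x.
  by rewrite /pseries; congr series; apply/funext => m /=; rewrite expr1n mulr1.
have x0 : 0 < 1 - x by rewrite -[x]mulr1 pos // ler01 lexx.
have -> : limn (pseries (fun m => m%:R^-1) x) = - ln (1 - x).
  by rewrite -c1; apply/eqP; rewrite -subr_eq0 opprK E c0.
by rewrite expRN lnK.
Qed.

Lemma pseries_inv_is_cvg x : `|x| < 1 -> cvgn (pseries (fun m => m%:R^-1) x).
Proof.
move=> x1; apply: (@geometric_bound_cvg _ _ 1) => //; last by rewrite mulr1.
exists 1 => // m; rewrite expr1n mul1r normfV normr_nat.
by case: m => [|m]; rewrite ?invr0 // invf_le1 ?ltr0n // ler1n.
Qed.

Lemma geometric_series_is_cvg u C q : 0 <= q -> q < 1 ->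
  (forall k, `|u k| <= C * q ^+ k) -> cvgn (series u).
Proof.
move=> q0 q1 Hu; have C0 : 0 <= C by have := Hu 0%N; rewrite mulr1; apply: le_trans.
have H : geometric_bound u q by exists C.
have := @geometric_bound_cvg _ u q 1 q0 H; rewrite normr1 mul1r => /(_ q1).
rewrite (_ : pseries u 1 = series u) //.
by rewrite /pseries; congr series; apply/funext => m /=; rewrite expr1n mulr1.
Qed.

Lemma geometric_series_tail u C q N : 0 <= q -> q < 1 ->
  (forall k, `|u k| <= C * q ^+ k) ->
  `|limn (series u) - series u N| <= C * q ^+ N / (1 - q).
Proof.
move=> q0 q1 Hu; have C0 : 0 <= C by have := Hu 0%N; rewrite mulr1; apply: le_trans.
have q1' : 0 < 1 - q by rewrite subr_gt0.
have Hcvg := geometric_series_is_cvg q0 q1 Hu.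
have H : `|series u (N + M)%N - series u N| @[M --> \oo] --> `|limn (series u) - series u N|.
  apply: cvg_norm; apply: cvgB; last exact: cvg_cst.
  rewrite (_ : (fun M => _) = [sequence (series u) (M + N)%N]_M) ?cvg_shiftn //.
  by apply/funext => M /=; rewrite addnC.
(* The exact finite geometric sum is kept so that the induction closes. *)
have Hp M : `|series u (N + M)%N - series u N| <= C * (q ^+ N - q ^+ (N + M)) / (1 - q).
  elim: M => [|M IH]; first by rewrite addn0 !subrr normr0 mulr0 mul0r.
  rewrite addnS [series u _.+1]/series /= big_nat_recr //= -/(series u _) addrAC.
  apply: le_trans (ler_normD _ _) _; apply: (le_trans (lerD IH (Hu _))).
  by rewrite le_eqVlt; apply/orP; left; apply/eqP; rewrite exprS; field; exact: lt0r_neq0.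
apply: (cvgr_to_le H); near=> M; apply: le_trans (Hp M) _.
by rewrite ler_wpM2r ?invr_ge0 ?(ltW q1') // ler_wpM2l // gerBl exprn_ge0.
Unshelve. all: by end_near. Qed.

(** With [q < r < 1], the factor [N * r ^+ N] stays bounded while [(q / r) ^+ N] tends to 0. *)
Lemma mul_natr_expr_cvg0 q : 0 <= q -> q < 1 -> N%:R * q ^+ N @[N --> \oo] --> 0.
Proof.
move=> q0 q1; pose r := (q + 1) / 2.
have [qr r1] : q < r /\ r < 1 by rewrite /r; split; lra.
have r0 : 0 < r by exact: le_lt_trans qr.
have qr0 : 0 <= q / r by rewrite divr_ge0 // ltW.
have qr1 : `|q / r| < 1 by rewrite ger0_norm // ltr_pdivrMr ?mul1r.
apply: (@squeeze_cvgr _ _ _ _ (cst 0) (geometric (1 - r)^-1 (q / r))).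
- near=> N; rewrite mulr_ge0 ?exprn_ge0 //=.
  have -> : q ^+ N = r ^+ N * (q / r) ^+ N.
    by rewrite -exprMn mulrCA mulfV ?mulr1 // gt_eqF.
  rewrite mulrA ler_wpM2r ?(exprn_ge0 _ qr0) //.
  apply: le_trans _ (natr_expr_bound N (ltW r0) r1).
  by rewrite ler_wpM2r ?exprn_ge0 ?(ltW r0) // ler_nat.
- exact: cvg_cst.
- exact: cvg_geometric.
Unshelve. all: by end_near. Qed.

End LogSeries.

(** * The logarithm of the orbit product as a double series over length and degree *)

Section OrbitProduct.
Context {R : realType} {n : nat} (A : 'M[R]_n) (C q : R).
Hypotheses (Adiag : forall i, A i i = 0) (Asym : A^T = A).
Hypotheses (C_ge0 : 0 <= C) (q_gt0 : 0 < q) (q_lt1 : q < 1).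
Hypothesis walk_bound : forall k,
  \sum_(s : k.+1.-tuple 'I_n) `|walk_weight A s| <= C * q ^+ k.+1.

Hypothesis diag_bound : forall i, geometric_bound (wcoef A i i) q.

Let q_ge0 : 0 <= q := ltW q_gt0.

Let orbit_bound L m : (0 < L)%N -> (0 < m)%N ->
  \sum_(O : {set L.-tuple 'I_n} | tb_orbit A O) `|orbit_weight A O| ^+ m <= C * q ^+ (m * L).
Proof.
move=> L0 m0; apply: le_trans (orbit_power_sum_le Adiag L0 m0) _.
have := walk_bound (m * L).-1; rewrite prednK // muln_gt0 L0 m0.
by [].
Qed.

(** By [orbit_bound] the powers of the weight tend to 0. *)
Let orbit_weight_lt1 L (O : {set L.-tuple 'I_n}) : (0 < L)%N -> tb_orbit A O ->
  `|orbit_weight A O| < 1.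
Proof.
move=> L0 HO; rewrite ltNge; apply/negP => w1.
suff : (1 : R) <= 0 by rewrite ler10.
have H : C * q ^+ N.+1 @[N --> \oo] --> (0 : R).
  rewrite -(mulr0 C); apply: cvgMl_tmp.
  have : q ^+ N @[N --> \oo] --> (0 : R) by apply: cvg_expr; rewrite ger0_norm.
  by rewrite -cvg_shiftS.
apply: (cvgr_to_ge H); near=> N.
apply: (@le_trans _ _ (`|orbit_weight A O| ^+ N.+1)); first exact: exprn_ege1.
apply: (@le_trans _ _ (C * q ^+ (N.+1 * L))); last first.
  by rewrite ler_wpM2l // ler_wiXn2l ?(ltW q_lt1) // leq_pmulr.
apply: le_trans (orbit_bound L0 (ltn0Sn N)).
by rewrite (bigD1 O) //= lerDl; apply: sumr_ge0 => O' _; rewrite exprn_ge0.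
Unshelve. all: by end_near. Qed.

(** The share of the orbits of length [L] in the coefficient of degree [k] of the logarithmic
    series. *)
Let e L k : R := if (0 < L)%N && (L %| k)%N then
  orbit_power_sum A L (k %/ L) / (k %/ L)%:R else 0.

Let e_bound L k : `|e L k| <= C * q ^+ k.
Proof.
rewrite /e; case: ifP => [/andP[L0 Lk]|_]; last by rewrite normr0 mulr_ge0 // exprn_ge0.
case: (posnP k) => [->|k0]; first by rewrite div0n invr0 mulr0 normr0 mulr1.
have m0 : (0 < k %/ L)%N by rewrite divn_gt0 // dvdn_leq.
rewrite normrM (@le_trans _ _ (`|orbit_power_sum A L (k %/ L)| * 1)) //.
  by rewrite ler_wpM2l // normfV normr_nat invf_le1 ?ltr0n // ler1n.
rewrite mulr1 -[X in q ^+ X](divnK Lk); apply: le_trans (orbit_bound L0 m0).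
apply: le_trans (ler_norm_sum _ _ _) _; apply: ler_sum => O _.
by rewrite normrX.
Qed.

Let E L : R := \sum_(O : {set L.-tuple 'I_n} | tb_orbit A O)
  limn (pseries (fun m => m%:R^-1) (orbit_weight A O)).

Let E_lim L : (0 < L)%N -> E L = limn (series (e L)).
Proof.
move=> L0.
have H1 : \sum_(O : {set L.-tuple 'I_n} | tb_orbit A O)
    pseries (fun m => m%:R^-1) (orbit_weight A O) j @[j --> \oo] --> E L.
  apply: cvg_big => [|O HO]; first exact: add_continuous.
  by apply: pseries_inv_is_cvg; exact: orbit_weight_lt1.
apply: (cvg_unique (@Rhausdorff R) H1).
(* The terms of [e L] live on multiples of [L], so [j] terms of the logarithm are the first [L * j]
   terms of [e L]. *)
rewrite (_ : (fun j => _) = series (e L) \o muln L).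
  have H := geometric_series_is_cvg q_ge0 q_lt1 (e_bound L).
  exact: (cvg_comp _ _ (@cvg_mulnl L L0) H).
apply/funext => j; rewrite /pseries /series /= exchange_big /=.
elim: j => [|j IH]; first by rewrite muln0 !big_geq.
rewrite big_nat_recr //= IH mulnSr [RHS](@big_cat_nat _ _ _ (L * j)) ?leq_addr //=; congr (_ + _).
rewrite -[X in \sum_(X <= _ < _) _]add0n big_addn addKn.
case: L L0 {IH H1} => // L _; rewrite big_nat_recl // [X in _ + X]big_nat.
rewrite [X in _ + X]big1 ?addr0; last first.
  by move=> r /andP[_ rL]; rewrite /e dvdn_addl ?dvdn_mulr // gtnNdvd.
rewrite /e add0n /= dvdn_mulr // mulKn // /orbit_power_sum mulr_suml.
by apply: eq_bigr => O _; rewrite mulrC.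
Qed.

Let E_tail L N : `|E L - series (e L) N| <= C * q ^+ N / (1 - q).
Proof.
case: (posnP L) => [->|L0]; last first.
  by rewrite E_lim //; exact: geometric_series_tail (e_bound L).
rewrite /E big1 => [|O /asboolP[[s [/andP[]]]]]; last by rewrite size_tuple.
rewrite /series /= big1 // subrr normr0.
by rewrite divr_ge0 ?mulr_ge0 ?exprn_ge0 // subr_ge0 ltW.
Qed.

Let partial_prodE N : tb_orbit_partial_prod A N = expR (\sum_(L < N) E L).
Proof.
rewrite expR_sum; apply: eq_bigr => L _; rewrite expR_sum; apply: eq_bigr => O HO.
rewrite expR_log_series //; apply: (orbit_weight_lt1 _ HO).
by case/asboolP: HO => [[s [/andP[]]]]; rewrite size_tuple.
Qed.

(** A length dividing a degree [0 < k < N] is itself below [N], so the square truncation captures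
    the whole coefficient of degree [k]. *)
Let sum_log_coef N : \sum_(L < N) series (e L) N = pseries (log_coef A) 1 N.
Proof.
rewrite /pseries /series /=; under eq_bigr do rewrite big_mkord.
rewrite exchange_big big_mkord; apply: eq_bigr => k _; rewrite expr1n mulr1 /log_coef.
case: k => -[|k] kN /=.
  by rewrite invr0 mulr0 big1 // => L _; rewrite /e; case: ifP => // _; rewrite div0n invr0 mulr0.
rewrite sum_wcoef_trivial // sum_trivial_walk_orbits // [RHS]big_mkcond /=.
rewrite -/(e _ _) (big_ord_widen _ (fun L => e L k.+1) kN) [RHS]big_mkcond.
apply: eq_bigr => L _; case: ifP => // /negbT; rewrite -leqNgt => Lk.
by rewrite /e gtnNdvd ?andbF.
Qed.

(** The logarithm of the partial product differs from the partial sum of [log_coef] by [N] tails,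
    each at most [C * q ^+ N / (1 - q)]. *)
Lemma tb_orbit_partial_prod_cvg :
  tb_orbit_partial_prod A N @[N --> \oo] --> expR (log_series A 1).
Proof.
rewrite (_ : (fun N => _) = expR \o (fun N => \sum_(L < N) E L)); last first.
  by apply/funext => N; rewrite partial_prodE.
apply: continuous_cvg; first exact: continuous_expR.
have Hc : cvgn (pseries (log_coef A) 1).
  have := geometric_bound_cvg (x := 1) q_ge0 (log_coef_bound diag_bound).
  by rewrite normr1 mul1r; apply.
rewrite -[log_series A 1]add0r.
rewrite (_ : (fun N => _) = (fun N => (\sum_(L < N) E L - pseries (log_coef A) 1 N)
    + pseries (log_coef A) 1 N)); last first.
  by apply/funext => N; rewrite subrK.
apply: cvgD; last exact: Hc.
apply/norm_cvg0P.
apply: (@squeeze_cvgr _ _ _ _ (cst 0) (fun N => C / (1 - q) * (N%:R * q ^+ N))).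
- near=> N; rewrite normr_ge0 /= -sum_log_coef -sumrB.
  apply: le_trans (ler_norm_sum _ _ _) _.
  apply: (@le_trans _ _ (\sum_(L < N) C * q ^+ N / (1 - q))); first by apply: ler_sum => L _; exact: E_tail.
  rewrite sumr_const card_ord -[leLHS]mulr_natl le_eqVlt; apply/orP; left; apply/eqP.
  by move: (1 - q)^-1 => z; ring.
- exact: cvg_cst.
- by rewrite -(mulr0 (C / (1 - q))); apply: cvgMl_tmp; exact: mul_natr_expr_cvg0.
Unshelve. all: by end_near. Qed.

End OrbitProduct.

Unset Implicit Arguments.

Theorem theorem2 (R : realType) (n : nat) (A : 'M[R]_n)
  (Asym : A^T = A) (Adiag : forall i, A i i = 0)
  (Arho : spectral_radius_lt1 (absmx A))
  (alpha : 'I_n -> 'I_n -> R)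
  (Halpha : forall k i : 'I_n, alpha_iter A t k i @[t --> \oo] --> alpha k i) :
  tb_orbit_partial_prod A N @[N --> \oo] --> Z_bp A alpha.
Proof.
have Bsym : (absmx A)^T = absmx A by rewrite /absmx map_trmx Asym.
have [C [q [C0 q0 q1 HB]]] := row_power_geometric Bsym Arho.
have diag_bound i : geometric_bound (wcoef A i i) q.
  exists C => // m; rewrite ger0_norm ?wcoef_ge0 //.
  apply: le_trans (wcoef_le_row_power i i m Asym Adiag) _.
  exact: le_trans (ler_norm _) (HB m i).
rewrite (Z_bpE Adiag (ltW q0) q1 diag_bound Asym Halpha).
(* The factor [n] comes from summing the row bounds over the starting vertices. *)
apply: (@tb_orbit_partial_prod_cvg R n A (n%:R * C) q) => //; first by rewrite mulr_ge0.
move=> k; apply: le_trans (sum_norm_walk_weight A k) _.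
apply: (@le_trans _ _ (\sum_(i < n) C * q ^+ k.+1)).
  by apply: ler_sum => i _; exact: le_trans (ler_norm _) (HB k.+1 i).
by rewrite sumr_const card_ord -mulrA mulr_natl.
Qed.
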